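(* Let $R>0$ and let $u_0\in\mathcal H^2$ satisfy $\|u_0\|_{\mathcal H^2}=1$ and $u_0=\Theta_R u_0$. Let $u=(u_1,u_2)\in C(\mathbb R;\mathcal H^2)$ be the global solution of $$-i\partial_s u=\begin{pmatrix} s & G\\ G^* & -s\end{pmatrix}u+\delta F(u)u,\qquad u(0)=u_0 .$$ Then there exist unique pairs $\alpha=(\alpha_1,\alpha_2)\in\mathcal H^2$ and $\omega=(\omega_1,\omega_2)\in\mathcal H^2$ such that: 1. As $s\to-\infty$, $$u_1(s)=e^{i\delta F_1(\alpha)s+i\varphi(s,GG^* )}\alpha_1+\mathcal O_R\left(\frac1{|s|}\right),\qquad u_2(s)=e^{i\delta F_2(\alpha)s-i\varphi(s,G^*G)}\alpha_2+\mathcal O_R\left(\frac1{|s|}\right).$$ 2. As $s\to+\infty$, $$u_1(s)=e^{i\delta F_1(\omega)s+i\varphi(s,GG^* )}\omega_1+\mathcal O_R\left(\frac1{s}\right),\qquad u_2(s)=e^{i\delta F_2(\omega)s-i\varphi(s,G^*G)}\omega_2+\mathcal O_R\left(\frac1{s}\right).$$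
   Context: Setting: $\mathcal H$ is a finite-dimensional complex Hilbert space, $G$ is an operator on $\mathcal H$ with adjoint $G^*$, satisfying $\chi(GG^* )G=G\chi(G^*G)$ and $\chi(G^*G)G^*=G^*\chi(GG^* )$ for every continuous $\chi:\mathbb R\to\mathbb R$ (functional calculus). $\delta\in\mathbb R$ is fixed. For $j=1,2$, $f_j\in C^2(\mathbb R^2;\mathbb R)$ has bounded Hessian, and for $u=(u_1,u_2)\in\mathcal H^2$ one sets $F_j(u)=f_j(\|u_1\|_{\mathcal H}^2,\|u_2\|_{\mathcal H}^2)\in\mathbb R$ and $F(u)=\mathrm{diag}(F_1(u),F_2(u))$, i.e. $F(u)(w_1,w_2)=(F_1(u)w_1,F_2(u)w_2)$. For each $u_0\in\mathcal H^2$ the equation has a unique global solution $u\in C(\mathbb R;\mathcal H^2)$, and $\|u_1(s)\|_{\mathcal H}^2+\|u_2(s)\|_{\mathcal H}^2$ is independent of $s$. Cut-off: $\theta\in C_0^\infty(\mathbb R)$ is a fixed function with $0\le\theta\le1$, $\theta(u)=0$ for $|u|>1$, $\theta(u)=1$ for $|u|<1/2$; for $R>0$, $\Theta_R=\mathrm{diag}\left(\theta(GG^*/R^2),\theta(G^*G/R^2)\right)$. Phase: $\varphi(s,\lambda)=\frac{s^2}{2}+\frac{\lambda}{2}\ln|s|$; $\varphi(s,GG^* )$ and $\varphi(s,G^*G)$ are defined by functional calculus. Notation: an $\mathcal H$-valued function $w(s)$ is $\mathcal O_R(b(s))$ if $\|w(s)\|_{\mathcal H}\le C_R|b(s)|$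 for a constant $C_R$ depending only on $R$ ($\mathcal H,G,\delta,f_1,f_2$ being fixed). *)

(* Defs.v *)
From HB Require Import structures.
From mathcomp Require Import all_boot all_order all_algebra.
From mathcomp Require Import complex.
From mathcomp Require Import all_classical all_reals all_analysis.

Set Implicit Arguments.
Unset Strict Implicit.
Unset Printing Implicit Defensive.

Import Order.TTheory GRing.Theory Num.Theory.
Import numFieldNormedType.Exports.

Local Open Scope classical_set_scope.
Local Open Scope ring_scope.
Local Open Scope complex_scope.

Section Hilbert.
Context {R : realType} {H : vectType R[i]}.
Variable ip : {dot H for Num.conj}.

Definition hnorm (x : H) : R := Num.sqrt (complex.Re (ip x x)).

Definition hnorm2 (u : H * H) : R :=
  Num.sqrt (hnorm u.1 ^+ 2 + hnorm u.2 ^+ 2).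

Definition is_adjoint (A B : 'End(H)) := forall x y : H, ip (A x) y = ip x (B y).

(* d is the derivative of w at s for the topology of the norm of H, which the
   bare vectType H does not carry. *)
Definition has_hderive (w : R -> H) (s : R) (d : H) :=
  (fun h : R => hnorm ((h^-1)%:C *: (w (s + h) - w s) - d)) @ 0^' --> (0 : R).

(* Orthogonal projection onto the eigenspace of A for the real eigenvalue l. *)
Definition spectral_proj (A : 'End(H)) (l : R) : 'End(H) :=
  daddv_pi (passmx.leigenspace A l%:C) (orthov ip (passmx.leigenspace A l%:C)).

(* Meaningful for self-adjoint A only: all the eigenvalues are then real and
   the sum, which has finite support, is the spectral calculus chi(A). *)
Definition funcalcC (chi : R -> R[i]) (A : 'End(H)) : 'End(H) :=
  \sum_(l \in [set l : R | passmx.leigenvalue A l%:C]) chi l *: spectral_proj A l.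

Definition funcalc (chi : R -> R) : 'End(H) -> 'End(H) :=
  funcalcC (fun l => (chi l)%:C).

Definition expi (t : R) : R[i] := cos t +i* sin t.

(* e^{iA}, for self-adjoint A. *)
Definition op_expi (A : 'End(H)) : 'End(H) := funcalcC expi A.

Definition nonlin (f : R * R -> R) (u : H * H) : R :=
  f (hnorm u.1 ^+ 2, hnorm u.2 ^+ 2).

Definition phase (s l : R) : R := s ^+ 2 / 2 + l / 2 * ln `|s|.

Section Equation.
Variables (G Gs : 'End(H)) (delta : R) (f1 f2 : R * R -> R).

Let GGs : 'End(H) := (G \o Gs)%VF.
Let GsG : 'End(H) := (Gs \o G)%VF.

Definition intertwining := forall chi : R -> R, continuous chi ->
  (funcalc chi GGs \o G = G \o funcalc chi GsG)%VF /\
  (funcalc chi GsG \o Gs = Gs \o funcalc chi GGs)%VF.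

Definition is_solution (u0 : H * H) (u : R -> H * H) :=
  u 0 = u0 /\
  forall s : R, exists du : H * H,
    [/\ has_hderive (fun t => (u t).1) s du.1,
        has_hderive (fun t => (u t).2) s du.2,
        (- 'i) *: du.1 = s%:C *: (u s).1 + G (u s).2
                         + (delta * nonlin f1 (u s))%:C *: (u s).1 &
        (- 'i) *: du.2 = Gs (u s).1 - s%:C *: (u s).2
                         + (delta * nonlin f2 (u s))%:C *: (u s).2].

Definition Theta (theta : R -> R) (r : R) (u : H * H) : H * H :=
  (funcalc (fun l => theta (l / r ^+ 2)) GGs u.1,
   funcalc (fun l => theta (l / r ^+ 2)) GsG u.2).

Definition profile (a : H * H) (s : R) : H * H :=
  (op_expi ((delta * nonlin f1 a * s)%:C *: \1%VF + funcalc (phase s) GGs) a.1,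
   op_expi ((delta * nonlin f2 a * s)%:C *: \1%VF - funcalc (phase s) GsG) a.2).

Definition remainder_le (C : R) (u : R -> H * H) (a : H * H) (s : R) :=
  hnorm ((u s).1 - (profile a s).1) <= C / `|s| /\
  hnorm ((u s).2 - (profile a s).2) <= C / `|s|.

Definition expansion_ninfty (C S : R) (u : R -> H * H) (a : H * H) :=
  forall s : R, s <= - S -> remainder_le C u a s.

Definition expansion_pinfty (C S : R) (u : R -> H * H) (a : H * H) :=
  forall s : R, S <= s -> remainder_le C u a s.

End Equation.
End Hilbert.

Section Smoothness.
Context {R : realType}.

Definition d1 (f : R * R -> R) : R * R -> R := 'D_((1, 0) : R * R) f.
Definition d2 (f : R * R -> R) : R * R -> R := 'D_((0, 1) : R * R) f.

Definition C1 (f : R * R -> R) :=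
  [/\ forall p, derivable f p ((1, 0) : R * R),
      forall p, derivable f p ((0, 1) : R * R),
      continuous (d1 f) & continuous (d2 f)].

Definition C2 (f : R * R -> R) := [/\ C1 f, C1 (d1 f) & C1 (d2 f)].

Definition bounded_hessian (f : R * R -> R) := exists M : R, forall p,
  [/\ `|d1 (d1 f) p| <= M, `|d2 (d1 f) p| <= M,
      `|d1 (d2 f) p| <= M & `|d2 (d2 f) p| <= M].

Definition is_cutoff (theta : R -> R) :=
  [/\ forall n x, derivable (derive1n n theta) x 1,
      forall x, 0 <= theta x <= 1,
      forall x, 1 < `|x| -> theta x = 0 &
      forall x, `|x| < 1 / 2 -> theta x = 1].

End Smoothness.

(* Main.v *)
(* In an orthonormal eigenbasis (e_k) of G G^*, the coordinates c = <u_1, e_k>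
   and g = <G u_2, e_k> satisfy the closed scalar system
     c' = i (s c + g + E_1 c),   g' = i (lambda c - s g + E_2 g),
   with E_j = delta F_j(u), and E_j is a function of N = |u_1|^2 alone, because
   |u_1|^2 + |u_2|^2 = 1.  With q = <G u_2, u_1>, one has N' = -2 Im q and
   q oscillates like e^{-i s^2}; integrations by parts give
   N = L - Re q / s + O(1/s^2).  The same kind of oscillating corrections turns
   e^{-i (E_1(L) s + phi(s, lambda))} c into a function with derivative
   O(1/s^2), which therefore converges at rate 1/s.  The conjugate coordinates
   of u_2 in an eigenbasis of G^* G solve a system of the same form, and
   u(-s) solves the equation for (-G, -G^*, -delta), which reduces -oo to +oo.
   The phases have modulus 1, so two candidate limits have coordinates of equal
   moduli, hence equal norms and equal phases, hence they agree. *)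
Require Import Defs.
From HB Require Import structures.
From mathcomp Require Import all_boot all_order all_algebra.
From mathcomp Require Import complex.
From mathcomp Require Import all_classical all_reals all_analysis.
From mathcomp Require Import ring lra.

Set Implicit Arguments.
Unset Strict Implicit.
Unset Printing Implicit Defensive.

Import Order.TTheory GRing.Theory Num.Theory.
Import numFieldNormedType.Exports.

Local Open Scope ring_scope.
Local Open Scope complex_scope.

(** The constant in the remainders may not depend on $u_0$, so every estimate is proved for a whole
    family of solutions indexed by a type [T], and at the end [T] is the type of all normalised
    solutions. The obstacle is the frequency: knowing only $N-L=O(1/s)$ leaves
    $E_1(N)-E_1(L)=O(1/s)$, which is not integrable and could make the phase drift logarithmically.
    Hence the need for $N$ up to $O(1/s^2)$: its $1/s$ term is the oscillating $\mathrm{Re}\,q/s$,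
    which can be integrated by parts, and the bounded Hessian makes the Taylor remainder of $E_1$ at
    $L$ of size $(N-L)^2=O(1/s^2)$. When $N'=-2\,\mathrm{Im}\,q$ is integrated by parts, the term
    $(E_2-E_1)\,\mathrm{Im}\,q$ appears with no smallness of its own. Since $E_2-E_1$ is a function
    of $N$ alone, this term is an exact derivative, namely that of $-\frac12 D(N)$ with $D$ a
    primitive of that function. *)

(** * Derivatives of complex-valued functions of a real variable *)

Section ComplexCalculus.
Context {R : realType}.
Implicit Types (v w : R -> R[i]) (z d : R[i]) (s : R).

Local Notation normc := (@ComplexField.Normc.normc R).

Lemma conjcD z d : conjc (z + d) = conjc z + conjc d.
Proof. exact: rmorphD. Qed.

Lemma conjcB z d : conjc (z - d) = conjc z - conjc d.
Proof. exact: rmorphB. Qed.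

Lemma conjcN z : conjc (- z) = - conjc z.
Proof. exact: rmorphN. Qed.

Lemma conjcM z d : conjc (z * d) = conjc z * conjc d.
Proof. exact: rmorphM. Qed.

Lemma conjc_sum I (r : seq I) (F : I -> R[i]) :
  conjc (\sum_(k <- r) F k) = \sum_(k <- r) conjc (F k).
Proof. exact: rmorph_sum. Qed.

Lemma conjc_i : conjc ('i%R : R[i]) = - 'i.
Proof. by rewrite -complexiE; apply/eqP; rewrite eq_complex /= oppr0 !eqxx. Qed.

Lemma mulii : 'i * 'i = -1 :> R[i].
Proof. by rewrite -expr2 sqr_i. Qed.

Lemma normcJ_real z : normc (conjc z) = normc z.
Proof. by case: z => a b /=; rewrite sqrrN. Qed.

Lemma normc_ge0 z : 0 <= normc z.
Proof. by case: z => a b; rewrite sqrtr_ge0. Qed.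

Lemma normc_real (x : R) : normc x%:C = `|x|.
Proof. by rewrite /= expr0n addr0 sqrtr_sqr. Qed.

Lemma normc_Re z : `|complex.Re z| <= normc z.
Proof. by case: z => a b /=; rewrite -sqrtr_sqr ler_wsqrtr// lerDl sqr_ge0. Qed.

Lemma normc_Im z : `|complex.Im z| <= normc z.
Proof. by case: z => a b /=; rewrite -sqrtr_sqr ler_wsqrtr// lerDr sqr_ge0. Qed.

Lemma normc_ReIm z : normc z <= `|complex.Re z| + `|complex.Im z|.
Proof.
case: z => a b /=.
rewrite -[leRHS]ger0_norm ?addr_ge0// -sqrtr_sqr ler_wsqrtr//.
by rewrite sqrrD !real_normK ?num_real// -addrA [leRHS]addrCA lerDr mulrn_wge0 ?mulr_ge0.
Qed.

Lemma sqr_normc_real z : (normc z ^+ 2)%:C = z * conjc z.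
Proof.
case: z => a b; rewrite /= sqr_sqrtr ?addr_ge0 ?sqr_ge0//.
by apply/eqP; rewrite eq_complex /=; apply/andP; split; apply/eqP; ring.
Qed.

Lemma normc_expi (t : R) : normc (expi t) = 1.
Proof. by rewrite /expi /= cos2Dsin2 sqrtr1. Qed.

Lemma expiD (a b : R) : expi (a + b) = expi a * expi b.
Proof.
by apply/eqP; rewrite eq_complex /= cosD sinD; apply/andP; split; apply/eqP; ring.
Qed.

Lemma expiN (a : R) : expi (- a) = conjc (expi a).
Proof. by rewrite /expi cosN sinN. Qed.

Lemma expi0 : expi (0 : R) = 1.
Proof. by rewrite /expi cos0 sin0. Qed.

Lemma expiK (a : R) : expi (- a) * expi a = 1.
Proof. by rewrite -expiD addNr expi0. Qed.

(** Split into real and imaginary parts because the monotonicity argument that yields limits, and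
    the chain rule through the real quantity $N$, live on real-valued functions. *)
Definition cderiv w s d :=
  is_derive s 1 (fun t => complex.Re (w t)) (complex.Re d) /\
  is_derive s 1 (fun t => complex.Im (w t)) (complex.Im d).

Lemma cderiv_eq w s d d' : cderiv w s d -> d = d' -> cderiv w s d'.
Proof. by move=> h <-. Qed.

Lemma cderiv_ext v w s d : v =1 w -> cderiv v s d -> cderiv w s d.
Proof. by move=> /funext ->. Qed.

Lemma cderiv_cst z s : cderiv (fun=> z) s 0.
Proof. by split; apply: is_derive_cst. Qed.

Lemma cderivD v w s d d' :
  cderiv v s d -> cderiv w s d' -> cderiv (fun t => v t + w t) s (d + d').
Proof.
move=> [h1 h2] [h3 h4]; split.
- have -> : (fun t => complex.Re (v t + w t)) =
            (fun t => complex.Re (v t)) \+ (fun t => complex.Re (w t)).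
    by apply/funext => t /=; case: (v t) (w t) => ? ? [? ?] /=.
  by rewrite (_ : complex.Re (d + d') = complex.Re d + complex.Re d');
    [apply: is_deriveD | case: d d' {h1 h2 h3 h4} => ? ? [? ?] /=].
- have -> : (fun t => complex.Im (v t + w t)) =
            (fun t => complex.Im (v t)) \+ (fun t => complex.Im (w t)).
    by apply/funext => t /=; case: (v t) (w t) => ? ? [? ?] /=.
  by rewrite (_ : complex.Im (d + d') = complex.Im d + complex.Im d');
    [apply: is_deriveD | case: d d' {h1 h2 h3 h4} => ? ? [? ?] /=].
Qed.

Lemma cderivM v w s d d' :
  cderiv v s d -> cderiv w s d' ->
  cderiv (fun t => v t * w t) s (d * w s + v s * d').
Proof.
move=> [h1 h2] [h3 h4]; split.
- have -> : (fun t => complex.Re (v t * w t)) =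
            ((fun t => complex.Re (v t)) * (fun t => complex.Re (w t))) -
            ((fun t => complex.Im (v t)) * (fun t => complex.Im (w t))).
    by apply/funext => t; rewrite !fctE; case: (v t) (w t) => ? ? [? ?] /=.
  apply: is_derive_eq.
  rewrite /GRing.scale /=.
  by case: d d' (v s) (w s) {h1 h2 h3 h4} => ? ? [? ?] [? ?] [? ?] /=; ring.
- have -> : (fun t => complex.Im (v t * w t)) =
            ((fun t => complex.Re (v t)) * (fun t => complex.Im (w t))) +
            ((fun t => complex.Im (v t)) * (fun t => complex.Re (w t))).
    by apply/funext => t; rewrite !fctE; case: (v t) (w t) => ? ? [? ?] /=.
  apply: is_derive_eq.
  rewrite /GRing.scale /=.
  by case: d d' (v s) (w s) {h1 h2 h3 h4} => ? ? [? ?] [? ?] [? ?] /=; ring.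
Qed.

Lemma cderivZ z w s d : cderiv w s d -> cderiv (fun t => z * w t) s (z * d).
Proof.
move=> h; apply: cderiv_eq (cderivM (cderiv_cst z s) h) _.
by rewrite mul0r add0r.
Qed.

Lemma cderivN w s d : cderiv w s d -> cderiv (fun t => - w t) s (- d).
Proof.
move=> h; apply: cderiv_eq (cderiv_ext _ (cderivZ (-1) h)) _ => [t|];
by rewrite mulN1r.
Qed.

Lemma cderivB v w s d d' :
  cderiv v s d -> cderiv w s d' -> cderiv (fun t => v t - w t) s (d - d').
Proof. by move=> h /cderivN; exact: cderivD. Qed.

Lemma cderivJ w s d : cderiv w s d -> cderiv (fun t => conjc (w t)) s (conjc d).
Proof.
move=> [h1 h2]; split.
- have -> : (fun t => complex.Re (conjc (w t))) = (fun t => complex.Re (w t)).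
    by apply/funext => t; case: (w t).
  by case: d h1 {h2}.
- have -> : (fun t => complex.Im (conjc (w t))) = - (fun t => complex.Im (w t)).
    by apply/funext => t; rewrite !fctE; case: (w t).
  by apply: is_derive_eq; case: d {h1 h2}.
Qed.

Lemma cderiv_real (f : R -> R) s (d : R) :
  is_derive s 1 f d -> cderiv (fun t => (f t)%:C) s d%:C.
Proof. by move=> h; split => //; apply: is_derive_cst. Qed.

Lemma cderiv_sum n (w : 'I_n -> R -> R[i]) s (d : 'I_n -> R[i]) :
  (forall k, cderiv (w k) s (d k)) ->
  cderiv (fun t => \sum_k w k t) s (\sum_k d k).
Proof.
elim: n w d => [|n IH] w d h.
  rewrite big_ord0; apply: cderiv_ext (cderiv_cst 0 s) => t.
  by rewrite big_ord0.
rewrite big_ord_recl; apply: cderiv_ext; last first.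
  by apply: cderivD (h ord0) (IH _ _ (fun k => h (lift ord0 k))).
by move=> t; rewrite big_ord_recl.
Qed.

Lemma cderiv_expi (f : R -> R) s (d : R) :
  is_derive s 1 f d -> cderiv (fun t => expi (f t)) s ('i * d%:C * expi (f s)).
Proof.
move=> h; split => /=.
- have -> : (fun t => cos (f t)) = cos \o f by [].
  by apply: is_derive_eq; ring.
- have -> : (fun t => sin (f t)) = sin \o f by [].
  by apply: is_derive_eq; ring.
Qed.

Lemma cderiv_Re w s d : cderiv w s d ->
  is_derive s 1 (fun t => complex.Re (w t)) (complex.Re d).
Proof. by case. Qed.

End ComplexCalculus.

(** * Convergence with a rate from decay of the derivative *)

Section DerivativeDecay.
Context {R : realType}.

Local Notation normc := (@ComplexField.Normc.normc R).

Lemma is_derive_continuous (f : R -> R) (x d : R) :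
  is_derive x 1 f d -> {for x, continuous f}.
Proof.
by case=> h _; exact/differentiable_continuous/derivable1_diffP.
Qed.

Lemma MVT_le (f df : R -> R) (a b : R) : a <= b ->
  (forall x, a <= x <= b -> is_derive x 1 f (df x)) ->
  exists2 c, a <= c <= b & f b - f a = df c * (b - a).
Proof.
move=> ab h.
have [| |c] := @MVT_segment R f df a b ab.
- by move=> x; rewrite in_itv /= => /andP[/ltW ax /ltW xb]; apply: h; rewrite ax.
- apply: continuous_in_subspaceT => x; rewrite inE /= in_itv /= => xab.
  exact: is_derive_continuous (h x xab).
- by rewrite in_itv /=; exists c.
Qed.

Lemma derive_ge0_homo (f df : R -> R) (a b : R) : a <= b ->
  (forall x, a <= x <= b -> is_derive x 1 f (df x)) ->
  (forall x, a <= x <= b -> 0 <= df x) -> f a <= f b.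
Proof.
move=> ab h h0; rewrite -subr_ge0; have [c hc ->] := MVT_le ab h.
by rewrite mulr_ge0 ?subr_ge0 // h0.
Qed.

Lemma is_derive_Vexp (n : nat) (s : R) : s != 0 ->
  is_derive s 1 (fun t : R => (t ^+ n.+1)^-1) (- n.+1%:R / s ^+ n.+2).
Proof.
move=> s0.
have dX : is_derive s 1 (fun t : R => t ^+ n.+1) (n.+1%:R * s ^+ n).
  have -> : (fun t : R => t ^+ n.+1) = (id : R -> R) ^+ n.+1.
    by apply/funext => t; rewrite exprfctE.
  by apply: is_derive_eq; rewrite /GRing.scale /= mulr1.
apply: (is_derive_eq (is_deriveV _ dX)); first by rewrite expf_neq0.
rewrite /GRing.scale /= -exprM.
have -> : (n.+1 * 2)%N = (n.+2 + n)%N by rewrite muln2 -addnn addSn addnS !addSn.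
by rewrite exprD; field; rewrite !expf_neq0.
Qed.

Lemma cderiv_Vexp (n : nat) (s : R) : s != 0 ->
  cderiv (fun t : R => ((t%:C) ^+ n.+1)^-1 : R[i]) s (- n.+1%:R * ((s%:C) ^+ n.+2)^-1).
Proof.
move=> s0; apply: cderiv_eq.
  apply: cderiv_ext (cderiv_real (is_derive_Vexp n s0)) => t.
  by rewrite fmorphV rmorphXn.
by rewrite rmorphM fmorphV rmorphXn rmorphN rmorph_nat.
Qed.

(* The functions [h + C/s^(n+1)] and [h - C/s^(n+1)] are monotone in opposite
   directions, so [h] is squeezed between them. *)
Lemma derive_decay_cvg (h h' : R -> R) (n : nat) (C : R) :
  (forall s : R, 1 <= s -> is_derive s 1 h (h' s)) ->
  (forall s : R, 1 <= s -> `|h' s| <= C / s ^+ n.+2) ->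
  exists L, forall s : R, 1 <= s -> `|h s - L| <= C / s ^+ n.+1.
Proof.
move=> dh bh.
have pos (s : R) : 1 <= s -> 0 < s by apply: lt_le_trans.
pose a s := h s + C * (s ^+ n.+1)^-1; pose b s := h s - C * (s ^+ n.+1)^-1.
have C0 : 0 <= C.
  by have := le_trans (normr_ge0 _) (bh 1 (lexx _)); rewrite expr1n divr1.
have dV (s : R) : 1 <= s -> is_derive s 1 (fun t : R => C * (t ^+ n.+1)^-1)
    (C * (- n.+1%:R / s ^+ n.+2)).
  move=> s1; apply: is_derive_eq.
    by apply: (@is_deriveZ _ _ _ (fun t : R => (t ^+ n.+1)^-1) C); apply: is_derive_Vexp;
    rewrite gt_eqF ?pos.
  by [].
(* Differentiating [C / s^(n+1)] produces a factor [n+1 >= 1], so its slope dominates the bound on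
   [h']. *)
have small (s : R) : 1 <= s -> C / s ^+ n.+2 <= C * (n.+1%:R / s ^+ n.+2).
  move=> s1; rewrite ler_wpM2l// ler_peMl ?ler1n// invr_ge0 exprn_ge0//.
  exact/ltW/pos.
have da (s : R) : 1 <= s -> is_derive s 1 a (h' s + C * (- n.+1%:R / s ^+ n.+2)).
  by move=> s1; apply: is_deriveD; [exact: dh | exact: dV].
have db (s : R) : 1 <= s -> is_derive s 1 b (h' s - C * (- n.+1%:R / s ^+ n.+2)).
  by move=> s1; apply: is_deriveB; [exact: dh | exact: dV].
have a_anti (x y : R) : 1 <= x -> x <= y -> a y <= a x.
  move=> x1 xy; rewrite -lerN2.
  apply: (@derive_ge0_homo (- a) (fun s => - (h' s + C * (- n.+1%:R / s ^+ n.+2))) _ _ xy).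
    by move=> s /andP[/(le_trans x1) s1 _]; apply: is_deriveN; exact: da.
  move=> s /andP[/(le_trans x1) s1 _]; have := bh s s1; rewrite ler_norml => /andP[_ h1].
  have := small s s1; rewrite mulNr mulrN; lra.
have b_homo (x y : R) : 1 <= x -> x <= y -> b x <= b y.
  move=> x1 xy.
  apply: (@derive_ge0_homo b (fun s => (h' s - C * (- n.+1%:R / s ^+ n.+2))) _ _ xy).
    by move=> s /andP[/(le_trans x1) s1 _]; exact: db.
  move=> s /andP[/(le_trans x1) s1 _]; have := bh s s1; rewrite ler_norml => /andP[h1 _].
  have := small s s1; rewrite mulNr mulrN; lra.
have ba (s : R) : 1 <= s -> b s <= a s.
  move=> s1; rewrite /a /b; suff : 0 <= C * (s ^+ n.+1)^-1 by lra.
  by rewrite mulr_ge0// invr_ge0 exprn_ge0// ltW// pos.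
have bta (s t : R) : 1 <= s -> 1 <= t -> b t <= a s.
  move=> s1 t1; case: (leP s t) => [st|/ltW ts].
    by apply: le_trans (ba t t1) _; exact: a_anti.
  by apply: le_trans (b_homo _ _ t1 ts) _; exact: ba.
(* Each value of [b] lies below each value of [a], so this supremum sits between [b s] and [a s] for
   every [s]. *)
exists (sup [set b t | t in [set t | 1 <= t]]) => s s1.
have hs : has_sup [set b t | t in [set t | 1 <= t]].
  split; first by exists (b 1), 1 => /=.
  by exists (a 1) => _ [t /= t1 <-]; exact: bta.
have h1 : b s <= sup [set b t | t in [set t | 1 <= t]].
  by apply: ub_le_sup; [case: hs | exists s].
have h2 : sup [set b t | t in [set t | 1 <= t]] <= a s.
  by apply: ge_sup; [case: hs | move=> _ [t /= t1 <-]; exact: bta].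
by move: h1 h2; rewrite /a /b ler_norml => *; apply/andP; split; lra.
Qed.

Lemma cderiv_decay_cvg (w w' : R -> R[i]) (n : nat) (C : R) :
  (forall s : R, 1 <= s -> cderiv w s (w' s)) ->
  (forall s : R, 1 <= s -> normc (w' s) <= C / s ^+ n.+2) ->
  exists L, forall s : R, 1 <= s -> normc (w s - L) <= (C *+ 2) / s ^+ n.+1.
Proof.
move=> dw bw.
have [L1 h1] := @derive_decay_cvg (fun s => complex.Re (w s))
  (fun s => complex.Re (w' s)) n C (fun s s1 => (dw s s1).1)
  (fun s s1 => le_trans (normc_Re _) (bw s s1)).
have [L2 h2] := @derive_decay_cvg (fun s => complex.Im (w s))
  (fun s => complex.Im (w' s)) n C (fun s s1 => (dw s s1).2)
  (fun s s1 => le_trans (normc_Im _) (bw s s1)).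
exists (L1 +i* L2) => s s1; apply: le_trans (normc_ReIm _) _.
move: (h1 s s1) (h2 s s1); case: (w s) => x y /= *.
by rewrite mulrnAl mulr2n lerD.
Qed.

End DerivativeDecay.

(** * Calculus of uniform $O(s^{-n})$ bounds *)

Section UniformDecay.
Context {R : realType} {T : Type}.
Implicit Types (f g : T -> R -> R[i]) (m n : nat).

Local Notation normc := (@ComplexField.Normc.normc R).

(* [T] indexes a family of solutions: the constant is uniform over it. *)
Definition udecay n f := exists C : R, forall t (s : R), 1 <= s -> normc (f t s) <= C / s ^+ n.

Lemma udecay_ge0 n f : udecay n f ->
  exists2 C : R, 0 <= C & forall t (s : R), 1 <= s -> normc (f t s) <= C / s ^+ n.
Proof.
move=> [C h]; exists `|C| => // t s s1; apply: le_trans (h t s s1) _.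
by rewrite ler_wpM2r ?ler_norm// invr_ge0 exprn_ge0// (le_trans ler01).
Qed.

Lemma udecay_le m n f : (n <= m)%N -> udecay m f -> udecay n f.
Proof.
move=> nm /udecay_ge0[C C0 h]; exists C => t s s1; apply: le_trans (h t s s1) _.
have s0 : 0 < s by apply: lt_le_trans s1.
by rewrite ler_wpM2l// lef_pV2 ?posrE ?exprn_gt0// ler_weXn2l.
Qed.

Lemma udecay_ext n f g : (forall (t : T) (s : R), 1 <= s -> f t s = g t s) ->
  udecay n f -> udecay n g.
Proof. by move=> e [C h]; exists C => t s s1; rewrite -e ?h. Qed.

Lemma udecayD n f g : udecay n f -> udecay n g -> udecay n (fun t s => f t s + g t s).
Proof.
move=> [C h] [D k]; exists (C + D) => t s s1.
by apply: le_trans (le_normcD _ _) _; rewrite mulrDl lerD ?h ?k.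
Qed.

Lemma udecayM m n f g : udecay m f -> udecay n g -> udecay (m + n) (fun t s => f t s * g t s).
Proof.
move=> [C h] [D k]; exists (C * D) => t s s1.
rewrite ComplexField.Normc.normcM exprD invfM mulrACA.
by rewrite ler_pM ?normc_ge0 ?h ?k.
Qed.

Lemma udecayMl n f g : udecay 0 f -> udecay n g -> udecay n (fun t s => f t s * g t s).
Proof. exact: udecayM. Qed.

Lemma udecayMr n f g : udecay n f -> udecay 0 g -> udecay n (fun t s => f t s * g t s).
Proof. by move=> h k; have := udecayM h k; rewrite addn0. Qed.

Lemma udecay_cst (z : R[i]) : udecay 0 (fun _ _ => z).
Proof. by exists (normc z) => t s _; rewrite expr0 divr1. Qed.

Lemma udecayN n f : udecay n f -> udecay n (fun t s => - f t s).
Proof. by move=> [C h]; exists C => t s s1; rewrite normcN h. Qed.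

Lemma udecayB n f g : udecay n f -> udecay n g -> udecay n (fun t s => f t s - g t s).
Proof. by move=> h /udecayN; exact: udecayD. Qed.

Lemma udecayJ n f : udecay n f -> udecay n (fun t s => conjc (f t s)).
Proof. by move=> [C h]; exists C => t s s1; rewrite normcJ_real h. Qed.

Lemma udecay_sum n I (r : seq I) (F : I -> T -> R -> R[i]) :
  (forall k, udecay n (F k)) -> udecay n (fun t s => \sum_(k <- r) F k t s).
Proof.
move=> h; elim: r => [|k r IH].
  exists 0 => t s s1; rewrite big_nil mul0r.
  by rewrite ComplexField.Normc.normc0.
apply: udecay_ext (udecayD (h k) IH) => t s _; by rewrite big_cons.
Qed.

Lemma udecay_inv n : udecay n (fun _ s => ((s%:C) ^+ n)^-1).
Proof.
exists 1 => t s s1; rewrite -rmorphXn -fmorphV normc_real div1r ger0_norm//.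
by rewrite invr_ge0 exprn_ge0// (le_trans ler01).
Qed.

Lemma udecay_cvg n f (f' : T -> R -> R[i]) :
  (forall (t : T) (s : R), 1 <= s -> cderiv (f t) s (f' t s)) -> udecay n.+2 f' ->
  exists L : T -> R[i], udecay n.+1 (fun t s => f t s - L t).
Proof.
move=> df [C h].
have cv t : exists L, forall s : R, 1 <= s -> normc (f t s - L) <= (C *+ 2) / s ^+ n.+1.
  by apply: cderiv_decay_cvg (df t) (h t).
exists (fun t => projT1 (cid (cv t))); exists (C *+ 2) => t s s1.
by case: cid => L /= hL; exact: hL.
Qed.

(** The device by which limits are identified below: a relation between limits is first obtained up
    to $O(1/s)$, and being independent of $s$ it is then exact. *)
Lemma udecay1_cst (a : T -> R[i]) : udecay 1 (fun t _ => a t) -> forall t, a t = 0.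
Proof.
move=> /udecay_ge0[C C0 h] t; apply: ComplexField.Normc.eq0_normc.
apply/eqP; rewrite eq_le normc_ge0 andbT leNgt; apply/negP => a0.
(* At this time the bound would read $|a|+C\le C$. *)
have s1 : 1 <= 1 + C / normc (a t) by rewrite lerDl divr_ge0// ltW.
have := h t _ s1; rewrite expr1 ler_pdivlMr ?(lt_le_trans ltr01)//.
by rewrite mulrDr mulr1 mulrCA divff ?gt_eqF// mulr1; lra.
Qed.

End UniformDecay.

(** * The phase, quadratic approximation and primitives *)

Section RealPreliminaries.
Context {R : realType}.

Lemma conjc_fixed_real (z : R[i]) : conjc z = z -> (complex.Re z)%:C = z.
Proof.
case: z => x y /= [h]; apply/eqP; rewrite eq_complex /= eqxx /=.
by apply/eqP; lra.
Qed.

Lemma is_derive_phase (s l : R) : 0 < s ->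
  is_derive s 1 (fun t => phase t l) (s + l / (2 * s)).
Proof.
move=> s0.
have dl : is_derive s 1 (fun t : R => ln `|t|) s^-1.
  apply: (near_eq_is_derive _ (is_derive1_ln s0)).
  near=> t; rewrite gtr0_norm//; near: t; exact: lt_nbhsr.
have -> : (fun t => phase t l) = (2^-1 *: ((id : R -> R) * (id : R -> R)))
    + ((l / 2) *: (fun t : R => ln `|t|)).
  by apply/funext => t; rewrite /phase !fctE /GRing.scale /= mulrC.
have d2 := is_deriveZ 2^-1 (is_deriveM (is_derive_id s (1 : R)) (is_derive_id s (1 : R))).
refine (is_derive_eq (is_deriveD d2 (is_deriveZ (l / 2) dl)) _).
by rewrite /GRing.scale /=; field; rewrite gt_eqF.
Unshelve. all: by end_near. Qed.

Lemma near_dist_le (x e : R) : 0 < e -> \forall y \near x, `|x - y| <= e.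
Proof.
by move=> e0; apply: (@cvgr_dist_le R R R (nbhs x) _ id x _ _ e0); exact: cvg_id.
Qed.

(** The only trace of the bounded Hessian that the oscillator analysis needs: a first-order Taylor
    formula with a remainder uniform in both points. *)
Definition quadratic_approx (e e' : R -> R) (K : R) :=
  forall x y, `|e y - e x - e' x * (y - x)| <= K * (y - x) ^+ 2.

Lemma quadratic_approx_continuous (e e' : R -> R) (K : R) :
  quadratic_approx e e' K -> continuous e.
Proof.
move=> h x; apply/cvgrPdist_le => eps eps0.
have B0 : 0 < `|e' x| + `|K| + 1 by rewrite ltr_wpDl// addr_ge0.
near=> y.
have xy1 : `|y - x| <= 1.
  by rewrite distrC; near: y; exact: near_dist_le.
have xye : `|y - x| * (`|e' x| + `|K| + 1) <= eps.
  rewrite -ler_pdivlMr// distrC; near: y.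
  by apply: near_dist_le; rewrite divr_gt0.
apply: le_trans xye; rewrite distrC.
have -> : e y - e x = (e y - e x - e' x * (y - x)) + e' x * (y - x) by ring.
apply: le_trans (ler_normD _ _) _; rewrite normrM.
apply: (@le_trans _ _ (`|K| * `|y - x| + `|e' x| * `|y - x|)); last first.
  by rewrite !mulrDr mulr1 !(mulrC `|y - x|) (addrC (`|K| * _)) lerDl.
rewrite lerD2r; apply: le_trans (h x y) _.
rewrite -(real_normK (num_real (y - x))) expr2.
apply: le_trans (ler_wpM2r _ (ler_norm K)) _; first by rewrite mulr_ge0.
by rewrite ler_wpM2l// ler_piMl.
Unshelve. all: by end_near. Qed.

Lemma quadratic_approx_bound (e e' : R -> R) (K : R) : quadratic_approx e e' K ->
  exists B : R, forall x, 0 <= x <= 1 -> `|e x| <= B /\ `|e' x| <= B.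
Proof.
(* The bound on [e' x] comes from the approximation between [x] and [x + 1], so [e] is first bounded
   on $[0,2]$. The three contributions, from [e x], [e (x + 1)] and the remainder, add up to this
   constant. *)
move=> h; exists (2 * `|e 0| + 3 * `|e' 0| + 6 * `|K|) => x /andP[x0 x1].
have bound y : 0 <= y <= 2 -> `|e y| <= `|e 0| + y * `|e' 0| + y ^+ 2 * `|K|.
  move=> /andP[y0 y2].
  have := h 0 y; rewrite subr0 => hy.
  have -> : e y = e 0 + e' 0 * y + (e y - e 0 - e' 0 * y) by ring.
  apply: le_trans (ler_normD _ _) _; apply: lerD.
    by apply: le_trans (ler_normD _ _) _; rewrite normrM (ger0_norm y0) mulrC.
  by apply: le_trans hy _; rewrite mulrC ler_wpM2l ?sqr_ge0 ?ler_norm.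
have ha0 := normr_ge0 (e 0); have hb0 := normr_ge0 (e' 0); have hK0 := normr_ge0 K.
have hx := bound x (introT andP (conj x0 (le_trans x1 (ler1n _ 2)))).
have hx1 : `|e (x + 1)| <= `|e 0| + (x + 1) * `|e' 0| + (x + 1) ^+ 2 * `|K|.
  by apply: bound; lra.
have := h x (x + 1); rewrite (_ : x + 1 - x = 1); last by ring.
rewrite mulr1 expr1n mulr1 => hd.
have hx2 : x ^+ 2 <= 1 by rewrite expr_le1.
have m1 : x * `|e' 0| <= `|e' 0| by rewrite ler_piMl.
have m2 : x ^+ 2 * `|K| <= `|K| by rewrite ler_piMl.
have m3 : x * `|K| <= `|K| by rewrite ler_piMl.
have := ler_norm K.
split; first lra.
move: hx1; have -> : (x + 1) ^+ 2 * `|K| = x ^+ 2 * `|K| + 2 * (x * `|K|) + `|K| by ring.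
rewrite mulrDl mul1r.
move: hx hd; rewrite !ler_norml => /andP[? ?] /andP[? ?] /andP[? ?].
by apply/andP; split; lra.
Qed.

(** Needed for the second component, whose squared norm is one minus that of the first. *)
Lemma quadratic_approx_reflect (e e' : R -> R) (K : R) : quadratic_approx e e' K ->
  quadratic_approx (fun x => e (1 - x)) (fun x => - e' (1 - x)) K.
Proof.
move=> h x y; have := h (1 - x) (1 - y).
have -> : 1 - y - (1 - x) = - (y - x) by ring.
by rewrite sqrrN mulrN mulNr.
Qed.

Lemma continuous_primitive01 (e : R -> R) : continuous e ->
  exists D : R -> R, forall x : R, 0 <= x <= 1 -> is_derive x 1 D (e x).
Proof.
move=> ce.
(* Integrating from $-1$, with $2$ as right end, keeps $[0,1]$ in the interior, so the derivative is
   two-sided at $0$ and $1$ as well. *)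
exists (fun x => \int[@lebesgue_measure R]_(t in `[(-1 : R), x]) e t)%R => x /andP[x0 x1].
have [ | | |d1 d2] := @continuous_FTC1_closed R e (-1) x 2 _ _ _ (ce x).
- by apply: le_lt_trans x1 _; rewrite ltr1n.
- apply: continuous_compact_integrable; first exact: segment_compact.
  exact: continuous_subspaceT.
- by apply: lt_le_trans x0; rewrite oppr_lt0.
by rewrite derive1E in d2; exact: (DeriveDef d1 d2).
Qed.

End RealPreliminaries.

(** * The scalar oscillator system: expansion of $N$ *)

Section OscillatorSystem.
Context {R : realType} {T : Type} {n : nat}.
Variables (lam : 'I_n -> R) (c g : T -> 'I_n -> R -> R[i]).
Variables (e1 e2 e1' e2' D : R -> R) (K1 K2 : R).

Local Notation normc := (@ComplexField.Normc.normc R).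

Let N t s : R := \sum_k normc (c t k s) ^+ 2.

Hypothesis he1 : quadratic_approx e1 e1' K1.
Hypothesis he2 : quadratic_approx e2 e2' K2.
Hypothesis hD : forall x : R, 0 <= x <= 1 -> is_derive x 1 D (e2 x - e1 x).
Hypothesis hN : forall t (s : R), 1 <= s -> N t s <= 1.
Hypothesis hg : forall k, udecay 0 (fun t => g t k).
Hypothesis dc : forall t k (s : R), 1 <= s ->
  cderiv (c t k) s ('i * (s%:C * c t k s + g t k s + (e1 (N t s))%:C * c t k s)).
Hypothesis dg : forall t k (s : R), 1 <= s ->
  cderiv (g t k) s ('i * ((lam k)%:C * c t k s - s%:C * g t k s + (e2 (N t s))%:C * g t k s)).

Let Nc t s : R[i] := (N t s)%:C.
Let E1 t s : R[i] := (e1 (N t s))%:C.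
Let E2 t s : R[i] := (e2 (N t s))%:C.
Let d t s := E2 t s - E1 t s.
(** For the first component of a solution, [q] is $\langle Gu_2,u_1\rangle$ and [p] is
    $\|G^*u_1\|^2-\|Gu_2\|^2$. The real and imaginary parts [r] and [m] of [q] stay complex-valued,
    which turns all derivative computations into algebraic identities in [R[i]]. *)
Let q t s := \sum_k g t k s * conjc (c t k s).
Let p t s := \sum_k ((lam k)%:C * (c t k s * conjc (c t k s)) - g t k s * conjc (g t k s)).
Let r t s : R[i] := (q t s + conjc (q t s)) / 2.
Let m t s : R[i] := - 'i * (q t s - conjc (q t s)) / 2.

Let NcE t s : Nc t s = \sum_k c t k s * conjc (c t k s).
Proof.
by rewrite /Nc /N rmorph_sum; apply: eq_bigr => k _; rewrite /= sqr_normc_real.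
Qed.

Let N_ge0 t s : 0 <= N t s.
Proof. by apply: sumr_ge0 => k _; rewrite sqr_ge0. Qed.

Let N01 t (s : R) : 1 <= s -> 0 <= N t s <= 1.
Proof. by move=> s1; rewrite N_ge0 hN. Qed.

Let qJ t s : conjc (q t s) = \sum_k c t k s * conjc (g t k s).
Proof.
by rewrite /q conjc_sum; apply: eq_bigr => k _; rewrite conjcM conjcK mulrC.
Qed.

Let mE t s : 'i * (q t s - conjc (q t s)) = - 2 * m t s.
Proof. by rewrite /m; field. Qed.

Let dNc t (s : R) : 1 <= s -> cderiv (Nc t) s (- 2 * m t s).
Proof.
move=> s1; rewrite -mE.
apply: (@cderiv_ext _ (fun s => \sum_k c t k s * conjc (c t k s))) => [u|].
  by rewrite NcE.
apply: cderiv_eq.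
  by apply: cderiv_sum => k; apply: cderivM (dc t k s1) (cderivJ (dc t k s1)).
rewrite qJ /q -sumrB mulr_sumr; apply: eq_bigr => k _.
rewrite !(conjcM, conjcD, conjcN, conjcB) conjc_i !conjc_real; ring.
Qed.

Let dq t (s : R) : 1 <= s ->
  cderiv (q t) s ('i * (- 2 * s%:C * q t s + p t s + d t s * q t s)).
Proof.
move=> s1; apply: cderiv_eq.
  by apply: cderiv_sum => k; apply: cderivM (dg t k s1) (cderivJ (dc t k s1)).
rewrite /q /p !mulr_sumr -!big_split mulr_sumr; apply: eq_bigr => k _ /=.
rewrite !(conjcM, conjcD, conjcN, conjcB) conjc_i !conjc_real /d /E1 /E2; ring.
Qed.

Let pJ t s : conjc (p t s) = p t s.
Proof.
rewrite /p conjc_sum; apply: eq_bigr => k _.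
rewrite !(conjcM, conjcB) !conjcK conjc_real; ring.
Qed.

Let dr t (s : R) : 1 <= s -> cderiv (r t) s ((2 * s%:C - d t s) * m t s).
Proof.
move=> s1; have h := dq t s1.
apply: cderiv_eq.
  by apply: cderiv_ext (cderivZ 2^-1 (cderivD h (cderivJ h))) => u; rewrite mulrC.
rewrite /m /d /E1 /E2 !(conjc_nat, conjcM, conjcD, conjcN, conjcB) conjc_i !conjc_real pJ.
by field.
Qed.

Let dm t (s : R) : 1 <= s ->
  cderiv (m t) s (- 2 * s%:C * r t s + p t s + d t s * r t s).
Proof.
move=> s1; have h := dq t s1.
apply: cderiv_eq.
  by apply: cderiv_ext (cderivZ (- 'i / 2) (cderivB h (cderivJ h))) => u; rewrite /m mulrAC.
rewrite /r /d /E1 /E2 !(conjc_nat, conjcM, conjcD, conjcN, conjcB) conjc_i !conjc_real pJ.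
set Q := q t s; set Q' := conjc Q; set P := p t s; set W := _%:C - _%:C; set S := s%:C.
have -> : (- 'i / 2 * ('i * (- (2) * S * Q + P + W * Q) - - 'i * (- (2) * S * Q' + P + W * Q'))
   = - ('i * 'i) * (- S * (Q + Q') + P + W * ((Q + Q') / 2)) :> R[i])%R by field.
by rewrite mulii; field.
Qed.

Let c0 k : udecay 0 (fun t => c t k).
Proof.
exists 1 => t s s1; rewrite expr0 divr1 -(@ler_pXn2r _ 2) ?nnegrE ?normc_ge0//.
rewrite expr1n; apply: le_trans (hN t s1).
by rewrite /N (bigD1 k) //= lerDl sumr_ge0 // => j _; rewrite sqr_ge0.
Qed.

Let q0 : udecay 0 q.
Proof. by apply: udecay_sum => k; apply: udecayMl (hg k) (udecayJ (c0 k)). Qed.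

Let p0 : udecay 0 p.
Proof.
apply: udecay_sum => k; apply: udecayB.
  by apply: udecayMl (udecay_cst _) (udecayMl (c0 k) (udecayJ (c0 k))).
exact: udecayMl (hg k) (udecayJ (hg k)).
Qed.

Let r0 : udecay 0 r.
Proof. exact: udecayMl (udecayD q0 (udecayJ q0)) (udecay_cst _). Qed.

Let m0 : udecay 0 m.
Proof.
exact: udecayMl (udecayMl (udecay_cst _) (udecayB q0 (udecayJ q0))) (udecay_cst _).
Qed.

Let E10 : udecay 0 E1.
Proof.
have [B hB] := quadratic_approx_bound he1.
by exists B => t s s1; rewrite expr0 divr1 normc_real (hB _ (N01 t s1)).1.
Qed.

Let E20 : udecay 0 E2.
Proof.
have [B hB] := quadratic_approx_bound he2.
by exists B => t s s1; rewrite expr0 divr1 normc_real (hB _ (N01 t s1)).1.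
Qed.

Let d0 : udecay 0 d. Proof. exact: udecayB E20 E10. Qed.

Let inv (j : nat) (t : T) (s : R) : R[i] := ((s%:C) ^+ j)^-1.

Let dinv j t (s : R) : 1 <= s -> cderiv (inv j.+1 t) s (- j.+1%:R * inv j.+2 t s).
Proof. by move=> s1; apply: cderiv_Vexp; rewrite gt_eqF// (lt_le_trans ltr01). Qed.

Let sC0 (s : R) : 1 <= s -> s%:C != 0 :> R[i].
Proof.
by move=> s1; rewrite fmorph_eq0 gt_eqF// (lt_le_trans ltr01).
Qed.

Let Dc t s : R[i] := (D (N t s))%:C.

Let dDc t (s : R) : 1 <= s -> cderiv (Dc t) s (d t s * (- 2 * m t s)).
Proof.
move=> s1; have h := cderiv_Re (dNc t s1).
apply: cderiv_eq.
  by apply: cderiv_real; apply: (is_derive1_comp (hD (N01 t s1)) h).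
have hm : (complex.Re (- 2 * m t s))%:C = - 2 * m t s.
  apply: conjc_fixed_real.
  by rewrite /m !(conjc_nat, conjc_inv, conjcM, conjcN, conjcB) conjc_i conjcK; field.
by rewrite -[in RHS]hm rmorphM rmorphB.
Qed.

Let D_lip : exists2 B : R, 0 <= B & forall x y, 0 <= x <= 1 -> 0 <= y <= 1 ->
  `|D x - D y| <= B * `|x - y|.
Proof.
have [B1 hB1] := quadratic_approx_bound he1.
have [B2 hB2] := quadratic_approx_bound he2.
have B0 : 0 <= B1 + B2.
  have h01 : 0 <= (0 : R) <= 1 by rewrite lexx ler01.
  by rewrite addr_ge0 ?(le_trans _ (hB1 0 h01).1) ?(le_trans _ (hB2 0 h01).1).
exists (B1 + B2) => // x y.
wlog yx : x y / y <= x => [wl hx hy|/andP[x0 x1] /andP[y0 y1]].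
  case: (leP y x) => [?|/ltW ?]; first exact: wl.
  by rewrite distrC (distrC x); exact: wl.
have [z /andP[yz zx] ->] := @MVT_le _ D (fun x => e2 x - e1 x) _ _ yx
  (fun z hz => hD (introT andP (conj (le_trans y0 (andP hz).1) (le_trans (andP hz).2 x1)))).
have hz : 0 <= z <= 1 by rewrite (le_trans y0 yz) (le_trans zx x1).
rewrite normrM ler_wpM2r// (le_trans (ler_normB _ _))// addrC.
by rewrite lerD ?(hB1 z hz).1 ?(hB2 z hz).1.
Qed.

Let Dc0 : udecay 0 Dc.
Proof.
have [B B0 hB] := D_lip.
exists (`|D 0| + B) => t s s1; rewrite expr0 divr1 normc_real.
have -> : D (N t s) = D 0 + (D (N t s) - D 0) by ring.
apply: le_trans (ler_normD _ _) _; rewrite lerD2l.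
apply: le_trans (hB _ _ (N01 t s1) _) _; first by rewrite lexx ler01.
by rewrite subr0 ger0_norm ?N_ge0// ler_piMr ?hN.
Qed.

Let invO j : udecay j (inv j). Proof. exact: udecay_inv. Qed.

(* [2 m = - N'], [d * m] is minus half the derivative of [D (N)], and
   [r' = (2 s - d) m], so that [N' = (D (N) / 2 - r)' / s]: this is what the
   correction [K] integrates by parts. *)
Let N_cvg : exists L : T -> R,
  (forall t, 0 <= L t <= 1) /\ udecay 1 (fun t s => Nc t s - (L t)%:C).
Proof.
pose K t s := Nc t s + (r t s - 2^-1 * Dc t s) * inv 1 t s.
have [|L1 hL1] := @udecay_cvg _ _ 0 K (fun t s => - (r t s - 2^-1 * Dc t s) * inv 2 t s) _
    (udecayMl (udecayN (udecayB r0 (udecayMl (udecay_cst _) Dc0))) (invO 2)).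
  move=> t s s1; apply: cderiv_eq.
    exact: cderivD (dNc t s1)
      (cderivM (cderivB (dr t s1) (cderivZ 2^-1 (dDc t s1))) (dinv 0 t s1)).
  by rewrite /inv; field; rewrite sC0.
have hL : udecay 1 (fun t s => Nc t s - L1 t).
  have := udecayB hL1 (udecayMl (udecayB r0 (udecayMl (udecay_cst 2^-1) Dc0)) (invO 1)).
  by apply: udecay_ext => t s _; rewrite /K; ring.
have [C hC] := hL.
pose L t := complex.Re (L1 t).
have hNL t s : 1 <= s -> `|N t s - L t| <= C / s ^+ 1.
  move=> s1; apply: le_trans (hC t s s1); apply: le_trans (normc_Re _).
  by rewrite /L /Nc; case: (L1 t).
exists L; split; last first.
  by exists C => t s s1; rewrite -rmorphB normc_real; exact: hNL.
(* The amount by which [L t] leaves $[0,1]$ is at most $|N-L|$, since $N$ stays in $[0,1]$. It does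
   not depend on time, hence it vanishes; [z2] treats the other end. *)
have z1 : forall t, (Num.max 0 (- L t))%:C = 0 :> R[i].
  apply: udecay1_cst; exists C => t s s1; apply: le_trans (hNL t s s1).
  rewrite normc_real; have := N_ge0 t s; have := ler_norm (N t s - L t) => h1 h2.
  by case: (leP 0 (- L t)) => [h|_]; [rewrite (ger0_norm h); lra | rewrite normr0].
have z2 : forall t, (Num.max 0 (L t - 1))%:C = 0 :> R[i].
  apply: udecay1_cst; exists C => t s s1; apply: le_trans (hNL t s s1).
  rewrite normc_real; have := hN t s1; have := ler_norm (L t - N t s); rewrite distrC => h1 h2.
  by case: (leP 0 (L t - 1)) => [h|_]; [rewrite (ger0_norm h); lra | rewrite normr0].
move=> t; apply/andP; split.
  case: (z1 t) => h; have : - L t <= Num.max 0 (- L t) by rewrite le_max lexx orbT.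
  by rewrite h; lra.
case: (z2 t) => h; have : L t - 1 <= Num.max 0 (L t - 1) by rewrite le_max lexx orbT.
by rewrite h; lra.
Qed.

(** Second pass of the integration by parts, now that $L$ is known. Centring $D(N)$ at $D(L)$ makes
    it $O(1/s)$ because $D$ is Lipschitz on $[0,1]$. *)
Let N_expansion : exists L : T -> R, [/\ forall t, 0 <= L t <= 1,
    udecay 1 (fun t s => Nc t s - (L t)%:C) &
    udecay 2 (fun t s => Nc t s - (L t)%:C + r t s * inv 1 t s)].
Proof.
have [L [L01 hL]] := N_cvg; exists L; split => //.
pose DL t : R[i] := (D (L t))%:C.
have hD1 : udecay 1 (fun t s => Dc t s - DL t).
  have [B B0 hB] := D_lip; have [C hC] := hL.
  exists (B * C) => t s s1; rewrite -rmorphB normc_real -mulrA.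
  apply: le_trans (hB _ _ (N01 t s1) (L01 t)) _; rewrite ler_wpM2l//.
  by apply: le_trans (hC t s s1); rewrite -rmorphB normc_real.
(* The last term removes the $-r/s^2$ left in the derivative by the first pass: as $m'=-2sr+O(1)$,
   the derivative of $-\frac12 m/s^3$ is $r/s^2+O(1/s^3)$. *)
pose K t s := Nc t s + (r t s - 2^-1 * (Dc t s - DL t)) * inv 1 t s - 2^-1 * (m t s * inv 3 t s).
have hK' : udecay 3 (fun t s => (2^-1 * (Dc t s - DL t)) * inv 2 t s
   + (- 2^-1 * (p t s + d t s * r t s)) * inv 3 t s + (3 / 2 * m t s) * inv 4 t s).
  apply: udecayD; first apply: udecayD.
  - exact: (udecayM (udecayMl (udecay_cst _) hD1) (invO 2)).
  - exact: udecayMl (udecayMl (udecay_cst _) (udecayD p0 (udecayMl d0 r0))) (invO 3).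
  - apply: udecayMl (udecayMl (udecay_cst _) m0) _; exact: (udecay_le _ (invO 4)).
have [|L1 hL1] := @udecay_cvg _ _ 1 K _ _ hK'.
  move=> t s s1; apply: cderiv_eq.
    apply: cderivB (cderivD (dNc t s1)
      (cderivM (cderivB (dr t s1) (cderivZ 2^-1 (cderivB (dDc t s1) (cderiv_cst _ _)))) (dinv 0 t s1))) _.
    exact: cderivZ (cderivM (dm t s1) (dinv 2 t s1)).
  by rewrite /inv; field; rewrite sC0.
have hK : udecay 2 (fun t s => K t s - (Nc t s + r t s * inv 1 t s)).
  have h1 : udecay 2 (fun t s => - 2^-1 * (Dc t s - DL t) * inv 1 t s).
    exact: (udecayM (udecayMl (udecay_cst _) hD1) (invO 1)).
  have h2 : udecay 2 (fun t s => 2^-1 * (m t s * inv 3 t s)).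
    apply: udecayMl (udecay_cst _) (udecayMl m0 _); exact: (udecay_le _ (invO 3)).
  by apply: udecay_ext (udecayB h1 h2) => t s _; rewrite /K; ring.
have hL2 : udecay 2 (fun t s => Nc t s - L1 t + r t s * inv 1 t s).
  by apply: udecay_ext (udecayB hL1 hK) => t s _; ring.
(* Both passes compute the limit of the same $N$. *)
have L1L : forall t, L1 t - (L t)%:C = 0.
  apply: udecay1_cst.
  have := udecayD (udecayB hL (udecay_le (isT : (1 <= 2)%N) hL2)) (udecayMl r0 (invO 1)).
  by apply: udecay_ext => t s _; ring.
by apply: udecay_ext hL2 => t s _; have /eqP := L1L t; rewrite subr_eq0 => /eqP ->.
Qed.

(** * The oscillator system: removal of the phase and limit of the coordinates *)

Section Limit.
Variable L : T -> R.
Hypothesis L01 : forall t, 0 <= L t <= 1.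
Hypothesis N_L1 : udecay 1 (fun t s => Nc t s - (L t)%:C).
Hypothesis N_L2 : udecay 2 (fun t s => Nc t s - (L t)%:C + r t s * inv 1 t s).

Let taylor (e e' : R -> R) (K : R) : quadratic_approx e e' K ->
  udecay 2 (fun t s => (e (N t s))%:C - (e (L t))%:C - (e' (L t))%:C * (Nc t s - (L t)%:C)).
Proof.
move=> he; have [C C0 hC] := udecay_ge0 N_L1; exists (`|K| * C ^+ 2) => t s s1.
rewrite -!(rmorphB, rmorphM) normc_real; apply: le_trans (he _ _) _.
apply: (@le_trans _ _ (`|K| * (N t s - L t) ^+ 2)).
  by rewrite ler_wpM2r ?sqr_ge0 ?ler_norm.
rewrite -mulrA ler_wpM2l// -(real_normK (num_real _)) -[X in _ * X]expr1.
rewrite -exprVn -exprMn ler_pXn2r ?nnegrE//; last first.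
  by rewrite mulr_ge0// invr_ge0 (le_trans ler01).
by have := hC t s s1; rewrite -rmorphB normc_real expr1.
Qed.

Let EL t : R[i] := (e1 (L t))%:C.
Let a t : R[i] := (e1' (L t))%:C.
Let dL t : R[i] := (e2 (L t))%:C - EL t.

Let bound_at_L (e : R -> R) : (exists B, forall x, 0 <= x <= 1 -> `|e x| <= B) ->
  udecay 0 (fun t _ => (e (L t))%:C).
Proof. by move=> [B h]; exists B => t s _; rewrite expr0 divr1 normc_real h. Qed.

Let EL0 : udecay 0 (fun t _ => EL t).
Proof.
have [B hB] := quadratic_approx_bound he1.
by apply: bound_at_L; exists B => x /hB[].
Qed.

Let a0 : udecay 0 (fun t _ => a t).
Proof.
have [B hB] := quadratic_approx_bound he1.
by apply: bound_at_L; exists B => x /hB[].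
Qed.

Let e2'L0 : udecay 0 (fun t _ => (e2' (L t))%:C).
Proof.
have [B hB] := quadratic_approx_bound he2.
by apply: bound_at_L; exists B => x /hB[].
Qed.

Let dL0 : udecay 0 (fun t _ => dL t).
Proof.
apply: udecayB EL0; have [B hB] := quadratic_approx_bound he2.
by apply: bound_at_L; exists B => x /hB[].
Qed.

Let E1_L : udecay 2 (fun t s => E1 t s - EL t + a t * (r t s * inv 1 t s)).
Proof.
by apply: udecay_ext (udecayD (taylor he1) (udecayMl a0 N_L2)) => t s _; rewrite /E1 /EL /a; ring.
Qed.

(** First order is enough here, because this difference enters [corrected'] with a further factor
    $1/s$. *)
Let E2_L : udecay 1 (fun t s => E2 t s - EL t - dL t).
Proof.
apply: udecay_ext (udecayD (udecay_le (isT : (1 <= 2)%N) (taylor he2))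
  (udecayMl e2'L0 N_L1)) => t s _.
by rewrite /E2 /EL /dL; ring.
Qed.

Let eps k t s := expi (- (e1 (L t) * s + phase s (lam k))).

Let deps k t (s : R) : 1 <= s -> cderiv (eps k t) s
  (- 'i * (EL t + s%:C + (lam k)%:C * 2^-1 * inv 1 t s) * eps k t s).
Proof.
move=> s1; have s0 : 0 < s by apply: lt_le_trans s1.
have d1 := is_deriveZ (e1 (L t)) (is_derive_id s (1 : R)).
have d2 : is_derive s 1 (fun u => - (e1 (L t) * u + phase u (lam k)))
    (- (e1 (L t) *: 1 + (s + lam k / (2 * s)))).
  exact: (is_deriveN (is_deriveD d1 (is_derive_phase (lam k) s0))).
apply: cderiv_eq (cderiv_expi d2) _.
have -> : (- (e1 (L t) *: 1 + (s + lam k / (2 * s)))) =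
   - (e1 (L t) + s + lam k * (2^-1 * s^-1)) :> R.
  by rewrite /GRing.scale /= mulr1 invfM addrA.
have -> : (- (e1 (L t) + s + lam k * (2^-1 * s^-1)))%:C =
   - (EL t + s%:C + (lam k)%:C * (2^-1 * inv 1 t s)) :> R[i].
  by rewrite rmorphN !rmorphD !rmorphM !fmorphV rmorph_nat /inv expr1.
by rewrite /eps; ring.
Qed.

(* The second term removes the oscillation of [g] from the derivative of
   [eps * c], the third one that of [d * g / s], and the last one that of
   [(E1 - EL) * c], which is [- a * r * c / s] up to [O(1/s^2)]. *)
Let corrected k t s : R[i] := eps k t s *
  (c t k s + 2^-1 * (g t k s * inv 1 t s) + dL t * 4^-1 * (g t k s * inv 2 t s)
   - 'i * a t * 2^-1 * (c t k s * m t s * inv 2 t s)).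

(** The derivative of [corrected] after cancellation of all terms of order $s$, $1$ and $1/s$,
    grouped so that each summand is a bounded factor times one that is visibly $O(1/s^2)$. *)
Let corrected' k t s : R[i] := eps k t s *
  ('i * c t k s * (E1 t s - EL t + a t * (r t s * inv 1 t s))
   + 'i * 2^-1 * g t k s * ((E2 t s - EL t - dL t) * inv 1 t s)
   + (- 'i * (lam k)%:C * 4^-1 * g t k s - 2^-1 * g t k s
      + 'i * dL t * 4^-1 * ((lam k)%:C * c t k s + (E2 t s - EL t) * g t k s)
      - 'i * 'i * a t * 2^-1 * m t s
        * (g t k s + (E1 t s - EL t) * c t k s - (lam k)%:C * 2^-1 * c t k s * inv 1 t s)
      - 'i * a t * 2^-1 * c t k s * (p t s + d t s * r t s)) * inv 2 t s
   + (- 'i * dL t * (lam k)%:C * 8^-1 * g t k s - dL t * 2^-1 * g t k s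
      + 'i * a t * c t k s * m t s) * inv 3 t s).

Let dcorrected k t (s : R) : 1 <= s -> cderiv (corrected k t) s (corrected' k t s).
Proof.
move=> s1; have G := dg t k s1; have C := dc t k s1.
apply: cderiv_eq.
  apply: cderivM (deps k t s1) _; apply: cderivB; first apply: cderivD; first apply: cderivD.
  - exact: C.
  - exact: cderivZ (cderivM G (dinv 0 t s1)).
  - exact: cderivZ (cderivM G (dinv 1 t s1)).
  - exact: cderivZ (cderivM (cderivM C (dm t s1)) (dinv 1 t s1)).
rewrite /corrected' -/(E1 t s) -/(E2 t s) /d /inv; field.
by rewrite sC0.
Qed.

Let eps0 k : udecay 0 (eps k).
Proof. by exists 1 => t s s1; rewrite normc_expi expr0 divr1. Qed.

Let corrected'_decay k : udecay 2 (corrected' k).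
Proof.
have I0 : udecay 0 (inv 1) by apply: udecay_le (invO 1).
have EEL : udecay 0 (fun t s => E1 t s - EL t) by exact: udecayB E10 EL0.
have EEL2 : udecay 0 (fun t s => E2 t s - EL t) by exact: udecayB E20 EL0.
have K z : udecay 0 (fun (_ : T) (_ : R) => z : R[i]) by exact: udecay_cst.
apply: udecayMl (eps0 k) _; apply: udecayD; first apply: udecayD; first apply: udecayD.
- exact: udecayMl (udecayMl (K _) (c0 k)) E1_L.
- apply: udecayMl (udecayMl (udecayMl (K _) (K _)) (hg k)) _.
  exact: (udecayM E2_L (invO 1)).
- apply: udecayMl _ (invO 2); apply: udecayB; first apply: udecayB; first apply: udecayD.
  + exact: udecayB (udecayMl (udecayMl (udecayMl (K _) (K _)) (K _)) (hg k))
      (udecayMl (K _) (hg k)).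
  + apply: udecayMl (udecayMl (udecayMl (K _) dL0) (K _)) _.
    exact: udecayD (udecayMl (K _) (c0 k)) (udecayMl EEL2 (hg k)).
  + apply: udecayMl (udecayMl (udecayMl (udecayMl (udecayMl (K _) (K _)) a0) (K _)) m0) _.
    apply: udecayB (udecayD (hg k) (udecayMl EEL (c0 k))) _.
    exact: udecayMl (udecayMl (udecayMl (K _) (K _)) (c0 k)) I0.
  + apply: udecayMl (udecayMl (udecayMl (udecayMl (K _) a0) (K _)) (c0 k)) _.
    exact: udecayD p0 (udecayMl d0 r0).
- apply: udecayMl _ (udecay_le (isT : (2 <= 3)%N) (invO 3)); apply: udecayD; first apply: udecayB.
  + exact: udecayMl (udecayMl (udecayMl (udecayMl (K _) dL0) (K _)) (K _)) (hg k).
  + exact: udecayMl (udecayMl dL0 (K _)) (hg k).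
  + exact: udecayMl (udecayMl (udecayMl (K _) a0) (c0 k)) m0.
Qed.

Let phase_limit k : exists gam : T -> R[i],
  udecay 1 (fun t s => c t k s - expi (e1 (L t) * s + phase s (lam k)) * gam t).
Proof.
have [gam h] := udecay_cvg (dcorrected k) (corrected'_decay k).
exists gam; have K z : udecay 0 (fun (_ : T) (_ : R) => z : R[i]) by exact: udecay_cst.
have I12 : udecay 1 (inv 2) by exact: udecay_le (invO 2).
have h1 : udecay 1 (fun t s => corrected k t s - eps k t s * c t k s).
  have h2 : udecay 1 (fun t s => eps k t s *
      (2^-1 * (g t k s * inv 1 t s) + dL t * 4^-1 * (g t k s * inv 2 t s)
      - 'i * a t * 2^-1 * (c t k s * m t s * inv 2 t s))).
    apply: udecayMl (eps0 k) (udecayB (udecayD _ _) _).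
    - exact: udecayMl (K _) (udecayMl (hg k) (invO 1)).
    - exact: udecayMl (udecayMl dL0 (K _)) (udecayMl (hg k) I12).
    - exact: udecayMl (udecayMl (udecayMl (K _) a0) (K _)) (udecayMl (udecayMl (c0 k) m0) I12).
  by apply: udecay_ext h2 => t s _; rewrite /corrected; ring.
(* The correction terms are $O(1/s)$ and [eps] has modulus one, so multiplying back by its conjugate
   keeps the rate. *)
have h3 := udecayMl (udecayJ (eps0 k)) (udecayB h h1).
apply: udecay_ext h3 => t s _.
have e1K : conjc (eps k t s) * eps k t s = 1 by rewrite -expiN expiK.
have -> : expi (e1 (L t) * s + phase s (lam k)) = conjc (eps k t s).
  by rewrite -expiN opprK.
rewrite -[in RHS](mul1r (c t k s)) -e1K; ring.
Qed.

(** The identity for [L] lets the limiting frequency be read off from the limit state itself, as in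
    the statement to be proved. It holds since the profile has constant squared norm and
    approximates [c], whose squared norm tends to [L]. *)
Lemma phase_limits : exists gam : T -> 'I_n -> R[i],
  (forall t, \sum_k normc (gam t k) ^+ 2 = L t) /\
  forall k, udecay 1 (fun t s => c t k s - expi (e1 (L t) * s + phase s (lam k)) * gam t k).
Proof.
have /choice [gam hgam] := phase_limit.
exists (fun t k => gam k t); split => // t.
pose w k t s := expi (e1 (L t) * s + phase s (lam k)) * gam k t.
have w0 k : udecay 0 (w k).
  apply: udecay_ext (udecayB (c0 k) (udecay_le (isT : (0 <= 1)%N) (hgam k))) => u s _.
  by rewrite /w; ring.
have ww k u s : w k u s * conjc (w k u s) = (normc (gam k u) ^+ 2)%:C.
  rewrite -sqr_normc_real /w ComplexField.Normc.normcM normc_expi mul1r //.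
have h : udecay 1 (fun u s => Nc u s - \sum_k (normc (gam k u) ^+ 2)%:C).
  have h1 : udecay 1 (fun u s => \sum_k ((c u k s - w k u s) * conjc (c u k s)
      + w k u s * conjc (c u k s - w k u s))).
    apply: udecay_sum => k; apply: udecayD.
      exact: udecayMr (hgam k) (udecayJ (c0 k)).
    exact: udecayMl (w0 k) (udecayJ (hgam k)).
  apply: udecay_ext h1 => u s _; rewrite NcE -sumrB; apply: eq_bigr => k _.
  by rewrite -(ww k u s) conjcB; ring.
have h2 : udecay 1 (fun u (_ : R) => (L u - \sum_k normc (gam k u) ^+ 2)%:C).
  by apply: udecay_ext (udecayB h N_L1) => u s _; rewrite rmorphB rmorph_sum /=; ring.
by case: (udecay1_cst h2 t) => /eqP; rewrite subr_eq0 => /eqP.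
Qed.

End Limit.

Lemma asymptotics_of_primitive : exists gam : T -> 'I_n -> R[i],
  udecay 1 (fun t s => (N t s)%:C - (\sum_k normc (gam t k) ^+ 2)%:C) /\
  forall k, udecay 1 (fun t s => c t k s -
    expi (e1 (\sum_j normc (gam t j) ^+ 2) * s + phase s (lam k)) * gam t k).
Proof.
have [L [L01 N_L1 N_L2]] := N_expansion.
have [gam [hL h]] := phase_limits L01 N_L1 N_L2.
exists gam; split; first by apply: udecay_ext N_L1 => t s _; rewrite hL.
by move=> k; apply: udecay_ext (h k) => t s _; rewrite hL.
Qed.

End OscillatorSystem.

(** Abstract in [c] and [g] so as to serve twice: for the coordinates of $u_1$, and for the
    conjugate coordinates of $u_2$. *)
Theorem oscillator_asymptotics (R : realType) (T : Type) (n : nat) (lam : 'I_n -> R)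
    (c g : T -> 'I_n -> R -> R[i]) (e1 e2 e1' e2' : R -> R) (K1 K2 : R)
    (N := fun t s => \sum_k ComplexField.Normc.normc (c t k s) ^+ 2) :
  quadratic_approx e1 e1' K1 -> quadratic_approx e2 e2' K2 ->
  (forall t (s : R), 1 <= s -> N t s <= 1) ->
  (forall k, udecay 0 (fun t => g t k)) ->
  (forall t k (s : R), 1 <= s ->
    cderiv (c t k) s ('i * (s%:C * c t k s + g t k s + (e1 (N t s))%:C * c t k s))) ->
  (forall t k (s : R), 1 <= s ->
    cderiv (g t k) s
      ('i * ((lam k)%:C * c t k s - s%:C * g t k s + (e2 (N t s))%:C * g t k s))) ->
  exists gam : T -> 'I_n -> R[i],
    udecay 1 (fun t s => (N t s)%:C - (\sum_k ComplexField.Normc.normc (gam t k) ^+ 2)%:C) /\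
    forall k, udecay 1 (fun t s => c t k s -
      expi (e1 (\sum_j ComplexField.Normc.normc (gam t j) ^+ 2) * s + phase s (lam k))
        * gam t k).
Proof.
move=> he1 he2 hN hg dc dg.
have ce : continuous (fun x => e2 x - e1 x).
  move=> x; apply: cvgB; first exact: (quadratic_approx_continuous he2).
  exact: (quadratic_approx_continuous he1).
have [D hD] := continuous_primitive01 ce.
exact: asymptotics_of_primitive he1 he2 hD hN hg dc dg.
Qed.

(** * Eigenbases and functional calculus of self-adjoint operators *)

Section HermitianSpectrum.
Context {R : realType} {H : vectType R[i]}.
Variable ip : {dot H for Num.conj}.
Implicit Types (x y v : H) (A : 'End(H)).

Local Notation normc := (@ComplexField.Normc.normc R).
Local Notation leigenspace := passmx.leigenspace.
Local Notation leigenvalue := passmx.leigenvalue.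

Lemma ipJ x y : ip x y = conjc (ip y x).
Proof. by rewrite hermC expr0 mul1r. Qed.

Lemma ipDl x y v : ip (x + y) v = ip x v + ip y v.
Proof. exact: linearDl. Qed.

Lemma ipBl x y v : ip (x - y) v = ip x v - ip y v.
Proof. exact: linearBl. Qed.

Lemma ipZl (a : R[i]) x v : ip (a *: x) v = a * ip x v.
Proof. exact: linearZl_LR. Qed.

Lemma ip0l v : ip 0 v = 0.
Proof. exact: linear0l. Qed.

Lemma ipZr (a : R[i]) x v : ip x (a *: v) = conjc a * ip x v.
Proof. by rewrite ipJ ipZl conjcM -ipJ. Qed.

Lemma ip_suml I (r : seq I) (F : I -> H) v :
  ip (\sum_(i <- r) F i) v = \sum_(i <- r) ip (F i) v.
Proof. exact: linear_sumlz. Qed.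

Lemma ip_self_real x : (complex.Re (ip x x))%:C = ip x x.
Proof. by apply: conjc_fixed_real; rewrite -ipJ. Qed.

Lemma ip_self_ge0 x : 0 <= complex.Re (ip x x).
Proof. by rewrite -ler0c ip_self_real; exact: dnorm_ge0. Qed.

Lemma sqr_hnorm x : (hnorm ip x ^+ 2)%:C = ip x x.
Proof. by rewrite sqr_sqrtr ?ip_self_ge0// ip_self_real. Qed.

Lemma hnorm_eq0 x : hnorm ip x = 0 -> x = 0.
Proof.
move=> h; have := sqr_hnorm x; rewrite h expr0n /= => h0.
by apply/eqP; rewrite -(dnorm_eq0 ip) -h0.
Qed.

Lemma Cauchy_Schwarz_hnorm x y : normc (ip x y) <= hnorm ip x * hnorm ip y.
Proof.
have := (CauchySchwarz ip x y).1.
rewrite -!sqr_hnorm -(rmorphM (real_complex R)) normc_def -(rmorphXn (real_complex R)) lecR.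
rewrite -exprMn ler_pXn2r ?nnegrE ?mulr_ge0 ?sqrtr_ge0//.
by case: (ip x y).
Qed.

Lemma endomorphism_eigenvector (U : vectType R[i]) (f : 'End(U)) :
  (0 < \dim {:U})%N -> exists2 v, v != 0 & exists a, f v = a *: v.
Proof.
move=> n0.
have bU := vbasisP {:U}.
have [a /eigenvalueP[v va v0]] := eigenvalue_closed (passmx.mxof (vbasis {:U}) (vbasis {:U}) f) n0.
exists (passmx.vecof (vbasis {:U}) v); first by rewrite passmx.vecof_eq0.
exists a; rewrite (passmx.hom_vecof _ bU) va /passmx.vecof scaler_sumr.
by apply: eq_bigr => i _; rewrite mxE scalerA.
Qed.

Lemma invariant_eigenvector A (W : {vspace H}) : (forall x, x \in W -> A x \in W) ->
  W != 0%VS -> exists2 v, v \in W & v != 0 /\ exists a, A v = a *: v.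
Proof.
move=> AW W0; pose f : 'End(subvs_of W) := linfun (vsproj W \o A \o vsval).
have [|v v0 [a fv]] := @endomorphism_eigenvector _ f.
  by rewrite dimvf /dim /= lt0n dimv_eq0.
exists (vsval v); first exact: subvsP.
split; first by apply: contra_neq v0 => h; apply: subvs_inj; rewrite h linear0.
exists a; rewrite -linearZ -fv lfunE /= vsprojK //.
by apply: AW; exact: subvsP.
Qed.

(** Completeness is phrased as the expansion formula, so [n] never has to be compared with the
    dimension of [H]. *)
Definition eigenbasis A n (e : 'I_n -> H) (lam : 'I_n -> R) :=
  [/\ forall i j, ip (e i) (e j) = (i == j)%:R,
      forall x, x = \sum_i ip x (e i) *: e i &
      forall i, A (e i) = (lam i)%:C *: e i].

Lemma self_adjoint_eigenbasis A : is_adjoint ip A A ->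
  exists n (e : 'I_n -> H) (lam : 'I_n -> R), eigenbasis A e lam.
Proof.
move=> hA.
(* Generalised to invariant subspaces: the part of [W] orthogonal to a unit eigenvector is again
   invariant, by self-adjointness, and of smaller dimension. *)
suff main m : forall W : {vspace H}, (\dim W <= m)%N -> (forall x, x \in W -> A x \in W) ->
    exists n (e : 'I_n -> H) (lam : 'I_n -> R),
    [/\ forall i j, ip (e i) (e j) = (i == j)%:R, forall i, e i \in W,
        forall x, x \in W -> x = \sum_i ip x (e i) *: e i &
        forall i, A (e i) = (lam i)%:C *: e i].
  have [n [e [lam [h1 _ h2 h3]]]] := main _ {:H}%VS (leqnn _) (fun x _ => memvf _).
  by exists n, e, lam; split => // x; apply: h2; exact: memvf.
elim: m => [|m IH] W dimW AW.
  have W0 : W = 0%VS by apply/eqP; rewrite -dimv_eq0 -leqn0.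
  exists 0, (fun=> 0), (fun=> 0); split; try by case.
  by move=> x; rewrite W0 memv0 big_ord0 => /eqP.
have [W0|W0] := eqVneq W 0%VS.
  exists 0, (fun=> 0), (fun=> 0); split; try by case.
  by move=> x; rewrite W0 memv0 big_ord0 => /eqP.
have [v0 v0W [v0N [a Av0]]] := invariant_eigenvector AW W0.
have hv0 : hnorm ip v0 != 0 by apply: contra_neq v0N => /hnorm_eq0.
pose v := (hnorm ip v0)^-1%:C *: v0.
have vW : v \in W by rewrite memvZ.
have vv : ip v v = 1.
  rewrite ipZl ipZr conjc_real -sqr_hnorm.
  transitivity ((hnorm ip v0)^-1 * ((hnorm ip v0)^-1 * hnorm ip v0 ^+ 2))%:C.
    by rewrite !rmorphM.
  by rewrite (_ : _ * _ = 1) //; field.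
have Av : A v = a *: v by rewrite /v linearZ /= Av0 !scalerA mulrC.
clearbody v.
have aR : (complex.Re a)%:C = a.
  apply: conjc_fixed_real; have := hA v v; rewrite Av ipZl ipZr vv !mulr1 //.
pose W' := (W :&: orthov ip <[v]>)%VS.
have W'P x : (x \in W') = (x \in W) && (ip x v == 0) by rewrite memv_cap mem_orthov1.
have [||n [e [lam [h1 h2 h3 h4]]]] := IH W'.
- rewrite -ltnS; apply: leq_trans dimW.
  rewrite ltn_neqAle dimvS ?capvSl// andbT; apply/negP => /eqP dE.
  have /eqP W'E : W' == W by rewrite eqEdim capvSl dE leqnn.
  by move: vW; rewrite -W'E W'P vv oner_eq0 andbF.
- move=> x; rewrite !W'P => /andP[xW /eqP xv]; rewrite AW//=.
  by rewrite hA Av ipZr xv mulr0.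
have e_v i : ip (e i) v = 0.
  by have := h2 i; rewrite W'P => /andP[_ /eqP].
have v_e i : ip v (e i) = 0 by rewrite ipJ e_v conjc0.
exists n.+1, (fun i => if unlift ord0 i is Some j then e j else v),
  (fun i => if unlift ord0 i is Some j then lam j else complex.Re a); split.
- move=> i j; case: unliftP => [i' ->|->]; case: unliftP => [j' ->|->].
  + by rewrite h1 (inj_eq lift_inj).
  + by rewrite e_v.
  + by rewrite v_e.
  + by rewrite vv eqxx.
- move=> i; case: unliftP => // j _.
  by have := h2 j; rewrite W'P => /andP[].
- move=> x xW; rewrite big_ord_recl unlift_none.
  have x'W : x - ip x v *: v \in W'.
    by rewrite W'P memvB ?memvZ//= ipBl ipZl vv mulr1 subrr.
  rewrite -[LHS](subrK (ip x v *: v)) addrC {1}(h3 _ x'W); congr (_ + _).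
  by apply: eq_bigr => i _; rewrite liftK ipBl ipZl v_e mulr0 subr0.
- by move=> i; case: unliftP => // _; rewrite aR.
Qed.

Section Eigenbasis.
Variables (A : 'End(H)) (n : nat) (e : 'I_n -> H) (lam : 'I_n -> R).
Hypothesis he : eigenbasis A e lam.

Lemma eigenbasis_coord x i : ip (A x) (e i) = (lam i)%:C * ip x (e i).
Proof.
have [ee ex eA] := he.
rewrite [X in ip (A X) _]ex linear_sum ip_suml (bigD1 i)//= big1 => [|j ji].
  by rewrite addr0 linearZ /= eA !ipZl ee eqxx mulr1 mulrC.
by rewrite linearZ /= eA !ipZl ee (negbTE ji) !mulr0.
Qed.

Lemma ip_parseval x y : ip x y = \sum_i ip x (e i) * conjc (ip y (e i)).
Proof.
have [_ ex _] := he.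
by rewrite {1}[x]ex ip_suml; apply: eq_bigr => i _; rewrite ipZl -ipJ.
Qed.

Lemma hnorm_parseval x : hnorm ip x ^+ 2 = \sum_i normc (ip x (e i)) ^+ 2.
Proof.
have /complexI : (hnorm ip x ^+ 2)%:C = (\sum_i normc (ip x (e i)) ^+ 2)%:C :> R[i].
  rewrite sqr_hnorm ip_parseval rmorph_sum; apply: eq_bigr => i _ /=.
  by rewrite sqr_normc_real.
by [].
Qed.

Lemma hnorm_le_sum x : hnorm ip x <= \sum_i normc (ip x (e i)).
Proof.
have s0 : 0 <= \sum_i normc (ip x (e i)) by apply: sumr_ge0 => i _; exact: normc_ge0.
rewrite -(@ler_pXn2r _ 2) ?nnegrE ?sqrtr_ge0// hnorm_parseval.
rewrite [leRHS]expr2 mulr_suml; apply: ler_sum => i _.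
rewrite expr2 ler_wpM2l ?normc_ge0// (bigD1 i)//= lerDl.
by apply: sumr_ge0 => j _; exact: normc_ge0.
Qed.

Lemma coord_inj x y : (forall i, ip x (e i) = ip y (e i)) -> x = y.
Proof.
have [_ ex _] := he => h; rewrite [x]ex [y]ex.
by apply: eq_bigr => i _; rewrite h.
Qed.

Lemma mem_leigenspace (B : 'End(H)) (l : R[i]) v :
  (v \in leigenspace B l) = (B v == l *: v).
Proof.
by rewrite memv_ker !lfun_simp subr_eq0.
Qed.

Lemma eigenspaces_orthogonal (l l' : R) v w :
  A v = l%:C *: v -> A w = l'%:C *: w -> l != l' -> ip v w = 0.
Proof.
move=> Av Aw ll'; rewrite ip_parseval big1 // => i _.
have := eigenbasis_coord v i; have := eigenbasis_coord w i.
rewrite Av Aw !ipZl => /eqP; rewrite -subr_eq0 -mulrBl mulf_eq0 => /orP[h1|/eqP->]; last first.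
  by rewrite conjc0 mulr0.
move=> /eqP; rewrite -subr_eq0 -mulrBl mulf_eq0 => /orP[h2|/eqP->]; last by rewrite mul0r.
move: h1 h2; rewrite -!rmorphB !fmorph_eq0 !subr_eq0 => /eqP h1 /eqP h2.
by move: ll'; rewrite h1 h2 eqxx.
Qed.

Lemma leigenspace_orthov (l : R[i]) :
  (leigenspace A l :&: orthov ip (leigenspace A l) = 0)%VS.
Proof.
apply/eqP; rewrite -subv0; apply/subvP => v; rewrite memv_cap memv0.
move=> /andP[vl /mem_orthovP/(_ v vl)].
by move/eqP; rewrite dnorm_eq0.
Qed.

(** Eigenvectors for another eigenvalue are orthogonal to the eigenspace, hence lie in the
    complement along which the projection is taken. *)
Lemma spectral_proj_eigenvector (l mu : R) v : A v = mu%:C *: v ->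
  spectral_proj ip A l v = if l == mu then v else 0.
Proof.
move=> Av; have dis := leigenspace_orthov l%:C.
case: eqVneq => [->|lmu].
  apply: daddv_pi_id; first exact: leigenspace_orthov.
  by rewrite mem_leigenspace Av.
have vo : v \in orthov ip (leigenspace A l%:C).
  apply/mem_orthovP => w; rewrite mem_leigenspace => /eqP Aw.
  by apply: eigenspaces_orthogonal Av Aw _; rewrite eq_sym.
have := daddv_pi_add dis (subvP (addvSr (leigenspace A l%:C) _) _ vo).
rewrite (daddv_pi_id (etrans (capvC _ _) dis) vo) -[RHS]add0r => /addIr.
exact.
Qed.

(** An eigenvector has a nonzero coordinate, which forces its eigenvalue to be one of the [lam i].
    Finiteness allows the sum over a set in [funcalcC] to be unfolded as a genuine finite sum. *)
Lemma finite_real_spectrum : finite_set [set l : R | leigenvalue A l%:C].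
Proof.
apply: (sub_finite_set _ (finite_seq (codom lam))).
move=> l /= l0; have [v vl v0] : exists2 v, v \in leigenspace A l%:C & v != 0.
  by exists (vpick (leigenspace A l%:C)); [exact: memv_pick | rewrite vpick0].
have Av : A v = l%:C *: v by apply/eqP; rewrite -mem_leigenspace.
have [[i hi]|h] := pselect (exists i, ip v (e i) != 0).
  have := eigenbasis_coord v i.
  by rewrite Av ipZl => /(mulIf hi) /complexI ->; exact: codom_f.
exfalso; move/negP: v0; apply; apply/eqP; apply: coord_inj => i; rewrite ip0l.
by apply/eqP; apply: contra_notT h => hi; exists i.
Qed.

Lemma funcalcC_eigenvector (chi : R -> R[i]) (mu : R) v : A v = mu%:C *: v ->
  funcalcC ip chi A v = chi mu *: v.
Proof.
move=> Av; have [->|v0] := eqVneq v 0; first by rewrite linear0 scaler0.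
rewrite /funcalcC fsbig_finite; last exact: finite_real_spectrum.
rewrite sum_lfunE (bigD1_seq mu) /=; first last.
- exact: finmap.fset_uniq.
- rewrite in_fset_set; last exact: finite_real_spectrum.
  rewrite inE /=; apply: contraNneq v0 => l0.
  by rewrite -memv0 -l0 mem_leigenspace Av.
rewrite big1 => [|l lmu]; rewrite lfunE /= (spectral_proj_eigenvector _ Av) ?eqxx ?addr0//.
by rewrite (negbTE lmu) scaler0.
Qed.

Lemma funcalc_eigenvector (chi : R -> R) (i : 'I_n) :
  funcalc ip chi A (e i) = (chi (lam i))%:C *: e i.
Proof. by apply: funcalcC_eigenvector; case: he. Qed.

End Eigenbasis.

(** The exponents in [profile] have this form with [b] equal to $1$ or $-1$, so [op_expi] of them is
    diagonal in the eigenbasis of [A]. *)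
Lemma eigenbasis_shift_funcalc A n (e : 'I_n -> H) (lam : 'I_n -> R)
    (a b : R) (chi : R -> R) : eigenbasis A e lam ->
  eigenbasis (a%:C *: \1%VF + b%:C *: funcalc ip chi A) e (fun i => a + b * chi (lam i)).
Proof.
move=> he; have [ee ex _] := he; split=> // i.
rewrite !lfunE /= !lfunE /= (funcalc_eigenvector he) id_lfunE scalerA -scalerDl.
by rewrite rmorphD rmorphM.
Qed.

Lemma op_expi_coord A n (e : 'I_n -> H) (lam : 'I_n -> R) x i : eigenbasis A e lam ->
  ip (op_expi ip A x) (e i) = expi (lam i) * ip x (e i).
Proof.
move=> he; have [ee ex eA] := he.
rewrite /op_expi [X in ip (_ X) _]ex linear_sum ip_suml (bigD1 i)//= big1 => [|j ji].
  by rewrite addr0 linearZ /= (funcalcC_eigenvector he expi (eA i)) !ipZl ee eqxx mulr1 mulrC.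
by rewrite linearZ /= (funcalcC_eigenvector he expi (eA j)) !ipZl ee (negbTE ji) !mulr0.
Qed.

Lemma is_derive_dominated (f b : R -> R) (s l : R) :
  (forall h : R, `|h^-1 * (f (s + h) - f s) - l| <= b h) ->
  (b @ 0^' --> (0 : R))%classic -> is_derive s 1 f l.
Proof.
move=> fb b0.
have cv : (h^-1 *: (f (h *: (1 : R) + s) - f s) @[h --> (0 : R)^'] --> l)%classic.
  apply/cvgrPdist_le => e e0; move/cvgrPdist_le : b0 => /(_ e e0); apply: filterS => h.
  rewrite sub0r normrN => he; rewrite distrC; apply: le_trans (ler_norm _) _.
  rewrite normr_id /GRing.scale /= mulr1 (addrC h).
  exact: le_trans (fb h) (le_trans (ler_norm _) he).
apply: DeriveDef; first by apply/cvg_ex; exists l.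
by rewrite /derive; apply: cvg_lim.
Qed.

(** Cauchy-Schwarz bounds the error of the scalar difference quotient by that of the vector one
    times the norm of [v]. *)
Lemma has_hderive_ip (w : R -> H) (s : R) (d v : H) :
  has_hderive ip w s d -> cderiv (fun t => ip (w t) v) s (ip d v).
Proof.
move=> hd.
pose b h := hnorm ip ((h^-1)%:C *: (w (s + h) - w s) - d) * hnorm ip v.
have b0 : (b @ 0^' --> (0 : R))%classic.
  by have := cvgM hd (cvg_cst (hnorm ip v)); rewrite mul0r; exact.
have bE h : normc ((h^-1)%:C * (ip (w (s + h)) v - ip (w s) v) - ip d v) <= b h.
  by rewrite -ipBl -ipZl -ipBl; exact: Cauchy_Schwarz_hnorm.
split; apply: is_derive_dominated b0 => h; apply: le_trans (bE h).
- apply: le_trans (normc_Re _).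
  by case: (ip (w (s + h)) v) (ip (w s) v) (ip d v) => ? ? [? ?] [? ?] /=; rewrite mul0r subr0.
- apply: le_trans (normc_Im _).
  by case: (ip (w (s + h)) v) (ip (w s) v) (ip d v) => ? ? [? ?] [? ?] /=; rewrite mul0r addr0.
Qed.

End HermitianSpectrum.

(** * Taylor's formula in two variables with bounded Hessian *)

Section HessianTaylor.
Context {R : realType}.
Implicit Types (f : R * R -> R).

Lemma is_derive_fst f x y : derivable f (x, y) ((1, 0) : R * R) ->
  is_derive x 1 (fun t => f (t, y)) (d1 f (x, y)).
Proof.
have E : (fun h : R => h^-1 *: ((f \o shift (x, y)) (h *: ((1, 0) : R * R)) - f (x, y))) =
    (fun h : R => h^-1 *: (((fun t => f (t, y)) \o shift x) (h *: (1 : R)) - f (x, y))).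
  apply/funext => h; congr (_ *: (f _ - _)).
  by congr (_, _); rewrite /= /GRing.scale /= mulr0 add0r.
move=> df; apply: DeriveDef.
  by rewrite /derivable -E.
by rewrite /d1 /derive -E.
Qed.

Lemma is_derive_snd f x y : derivable f (x, y) ((0, 1) : R * R) ->
  is_derive y 1 (fun t => f (x, t)) (d2 f (x, y)).
Proof.
have E : (fun h : R => h^-1 *: ((f \o shift (x, y)) (h *: ((0, 1) : R * R)) - f (x, y))) =
    (fun h : R => h^-1 *: (((fun t => f (x, t)) \o shift y) (h *: (1 : R)) - f (x, y))).
  apply/funext => h; congr (_ *: (f _ - _)).
  by congr (_, _); rewrite /= /GRing.scale /= mulr0 add0r.
move=> df; apply: DeriveDef.
  by rewrite /derivable -E.
by rewrite /d2 /derive -E.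
Qed.

Lemma MVT_dist (g g' : R -> R) (x y : R) : (forall t : R, is_derive t 1 g (g' t)) ->
  exists2 c, `|c - x| <= `|y - x| & g y - g x = g' c * (y - x).
Proof.
move=> dg; case: (leP x y) => [xy|/ltW yx].
  have [c /andP[xc cy] ->] := MVT_le xy (fun t _ => dg t).
  by exists c => //; rewrite !ger0_norm ?subr_ge0// lerB.
have [c /andP[yc cx] h] := MVT_le yx (fun t _ => dg t).
exists c; first by rewrite !ler0_norm ?subr_le0// lerN2 lerB.
by rewrite -opprB h; ring.
Qed.

Lemma lipschitz_of_derive (g g' : R -> R) (M x y : R) :
  (forall t : R, is_derive t 1 g (g' t)) -> (forall t, `|g' t| <= M) ->
  `|g y - g x| <= M * `|y - x|.
Proof.
move=> dg hM; have [c _ ->] := MVT_dist x y dg.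
by rewrite normrM ler_wpM2r.
Qed.

(** The increment is split along the path $(x,y),(x,y'),(x',y')$ and the mean value theorem is
    applied on each leg, first to [f], then to its partial derivatives. What remains is short of the
    claimed bound by $M|x'-x||y'-y|$. *)
Lemma hessian_taylor f : C2 f -> bounded_hessian f ->
  exists2 M : R, 0 <= M & forall x y x' y' : R,
    `|f (x', y') - f (x, y) - d1 f (x, y) * (x' - x) - d2 f (x, y) * (y' - y)|
      <= M * (`|x' - x| + `|y' - y|) ^+ 2.
Proof.
move=> [[Df1 Df2 _ _] [D11 D12 _ _] [D21 D22 _ _]] [M hM].
have M0 : 0 <= M by have [+ _ _ _] := hM (0, 0); exact: le_trans.
exists M => // x y x' y'.
have [c hc ec] := MVT_dist x x' (fun t => is_derive_fst (Df1 (t, y'))).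
have [b hb eb] := MVT_dist y y' (fun t => is_derive_snd (Df2 (x, t))).
have h1 : `|d1 f (c, y') - d1 f (x, y)| <= M * (`|x' - x| + `|y' - y|).
  have -> : d1 f (c, y') - d1 f (x, y) =
      (d1 f (c, y') - d1 f (x, y')) + (d1 f (x, y') - d1 f (x, y)) by ring.
  apply: le_trans (ler_normD _ _) _; rewrite mulrDr; apply: lerD.
    apply: le_trans (ler_wpM2l M0 hc).
    apply: (lipschitz_of_derive _ _ (fun t => is_derive_fst (D11 (t, y')))) => t.
    by case: (hM (t, y')) => b11 _ _ _; exact: b11.
  apply: (lipschitz_of_derive _ _ (fun t => is_derive_snd (D12 (x, t)))) => t.
  by case: (hM (x, t)) => _ b21 _ _; exact: b21.
have h2 : `|d2 f (x, b) - d2 f (x, y)| <= M * `|y' - y|.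
  apply: le_trans (ler_wpM2l M0 hb).
  apply: (lipschitz_of_derive _ _ (fun t => is_derive_snd (D22 (x, t)))) => t.
  by case: (hM (x, t)) => _ _ _ b22; exact: b22.
have -> : f (x', y') - f (x, y) - d1 f (x, y) * (x' - x) - d2 f (x, y) * (y' - y) =
   (d1 f (c, y') - d1 f (x, y)) * (x' - x) + (d2 f (x, b) - d2 f (x, y)) * (y' - y).
  rewrite !mulrBl -ec -eb; ring.
apply: le_trans (ler_normD _ _) _; rewrite !normrM.
apply: (@le_trans _ _ (M * (`|x' - x| + `|y' - y|) * `|x' - x| + M * `|y' - y| * `|y' - y|)).
  by apply: lerD; rewrite ler_wpM2r.
rewrite -subr_ge0.
have -> : M * (`|x' - x| + `|y' - y|) ^+ 2 -
   (M * (`|x' - x| + `|y' - y|) * `|x' - x| + M * `|y' - y| * `|y' - y|) =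
   M * (`|x' - x| * `|y' - y|) by ring.
by rewrite !mulr_ge0.
Qed.

Lemma quadratic_approx_on_simplex f (a : R) : C2 f -> bounded_hessian f ->
  exists e' K, quadratic_approx (fun x => a * f (x, 1 - x)) e' K.
Proof.
move=> h1 h2; have [M M0 hM] := hessian_taylor h1 h2.
(* Both arguments of [f] move by $|y-x|$, whence $4=2^2$. *)
exists (fun x => a * (d1 f (x, 1 - x) - d2 f (x, 1 - x))), (`|a| * (M * 4)) => x y.
have -> : a * f (y, 1 - y) - a * f (x, 1 - x) - a * (d1 f (x, 1 - x) - d2 f (x, 1 - x)) * (y - x)
  = a * (f (y, 1 - y) - f (x, 1 - x) - d1 f (x, 1 - x) * (y - x)
         - d2 f (x, 1 - x) * ((1 - y) - (1 - x))) by ring.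
rewrite normrM -mulrA ler_wpM2l//; apply: le_trans (hM _ _ _ _) _.
have -> : 1 - y - (1 - x) = - (y - x) by ring.
rewrite normrN -mulr2n -[`|y - x| *+ 2]mulr_natl exprMn real_normK ?num_real//.
by rewrite (_ : 2%:R ^+ 2 = 4) ?mulrA//; ring.
Qed.

End HessianTaylor.

(** * From the equation to the oscillator system *)

Section Solutions.
Context {R : realType} {H : vectType R[i]}.
Variable ip : {dot H for Num.conj}.
Implicit Types (u : R -> H * H) (a : H * H) (x y v w : H).

Local Notation normc := (@ComplexField.Normc.normc R).

Lemma adjoint_sym (G Gs : 'End(H)) : is_adjoint ip G Gs -> is_adjoint ip Gs G.
Proof. by move=> h x y; rewrite ipJ -h -ipJ. Qed.

Lemma adjoint_comp (G Gs : 'End(H)) : is_adjoint ip G Gs ->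
  is_adjoint ip (G \o Gs)%VF (G \o Gs)%VF.
Proof.
by move=> h x y; rewrite !lfunE /= h (adjoint_sym h).
Qed.

Section Evolution.
Variables (G Gs : 'End(H)) (delta : R) (f1 f2 : R * R -> R).
Hypothesis hadj : is_adjoint ip G Gs.

Local Notation sol := (is_solution ip G Gs delta f1 f2).

Let invi (d v : H) : (- 'i) *: d = v -> d = 'i *: v.
Proof. by move=> <-; rewrite scalerA mulrN mulii opprK scale1r. Qed.

Lemma solution_coord1 (u0 : H * H) u (s : R) v : sol u0 u ->
  cderiv (fun t => ip (u t).1 v) s
    ('i * (s%:C * ip (u s).1 v + ip (G (u s).2) v
           + (delta * nonlin ip f1 (u s))%:C * ip (u s).1 v)).
Proof.
move=> [_ /(_ s)[du [/has_hderive_ip h _ /invi e _]]].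
by apply: cderiv_eq (h v) _; rewrite e ipZl !ipDl !ipZl.
Qed.

Lemma solution_coord2 (u0 : H * H) u (s : R) v : sol u0 u ->
  cderiv (fun t => ip (u t).2 v) s
    ('i * (ip (Gs (u s).1) v - s%:C * ip (u s).2 v
           + (delta * nonlin ip f2 (u s))%:C * ip (u s).2 v)).
Proof.
move=> [_ /(_ s)[du [_ /has_hderive_ip h _ /invi e]]].
by apply: cderiv_eq (h v) _; rewrite e ipZl !ipDl -scaleNr !ipZl mulNr.
Qed.

(** The real diagonal terms cancel in the derivative and the coupling terms cancel by adjointness.
    The computation goes through coordinates because [cderiv] concerns scalar functions. *)
Lemma solution_norm (u0 : H * H) u (s : R) : hnorm2 ip u0 = 1 -> sol u0 u ->
  hnorm ip (u s).1 ^+ 2 + hnorm ip (u s).2 ^+ 2 = 1.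
Proof.
move=> n0 su.
have [n [e [lam he]]] := self_adjoint_eigenbasis (adjoint_comp hadj).
pose M t : R[i] := ip (u t).1 (u t).1 + ip (u t).2 (u t).2.
have ME t : M t = \sum_k ip (u t).1 (e k) * conjc (ip (u t).1 (e k))
   + \sum_k ip (u t).2 (e k) * conjc (ip (u t).2 (e k)).
  by rewrite /M !(ip_parseval he).
have dM t : cderiv M t 0.
  apply: cderiv_ext (fun r => esym (ME r)) _; apply: cderiv_eq.
    apply: cderivD; apply: cderiv_sum => k.
      exact: cderivM (solution_coord1 t (e k) su) (cderivJ (solution_coord1 t (e k) su)).
    exact: cderivM (solution_coord2 t (e k) su) (cderivJ (solution_coord2 t (e k) su)).
  transitivity ('i * (ip (G (u t).2) (u t).1 - ip (u t).1 (G (u t).2)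
      + ip (Gs (u t).1) (u t).2 - ip (u t).2 (Gs (u t).1)) : R[i]); last first.
    by rewrite hadj (adjoint_sym hadj); ring.
  rewrite !(ip_parseval he) -big_split -!sumrB -big_split -sumrB mulr_sumr /=.
  apply: eq_bigr => k _.
  by rewrite !(conjcM, conjcD, conjcN, conjcB) conjc_i !conjc_real; ring.
have cM t : complex.Re (M t) = hnorm ip (u t).1 ^+ 2 + hnorm ip (u t).2 ^+ 2.
  by rewrite /M -!sqr_hnorm -rmorphD.
rewrite -cM (@is_derive_0_is_cst _ _ s 0 (fun t => (dM t).1)) cM.
have [-> _] := su; move: n0; rewrite /hnorm2 => n0.
by rewrite -[LHS]sqr_sqrtr ?addr_ge0 ?sqr_ge0// n0 expr1n.
Qed.

Let GGs : 'End(H) := (G \o Gs)%VF.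
Let GsG : 'End(H) := (Gs \o G)%VF.

Lemma profile_coord1 a n (e : 'I_n -> H) (lam : 'I_n -> R) s k :
  eigenbasis ip GGs e lam ->
  ip (profile ip G Gs delta f1 f2 a s).1 (e k)
    = expi (delta * nonlin ip f1 a * s + phase s (lam k)) * ip a.1 (e k).
Proof.
move=> he; rewrite /profile /= -[funcalc ip (phase s) _]scale1r.
rewrite (op_expi_coord _ _ (eigenbasis_shift_funcalc (delta * nonlin ip f1 a * s) 1 (phase s) he)).
by rewrite mul1r.
Qed.

Lemma profile_coord2 a n (e : 'I_n -> H) (lam : 'I_n -> R) s k :
  eigenbasis ip GsG e lam ->
  ip (profile ip G Gs delta f1 f2 a s).2 (e k)
    = expi (delta * nonlin ip f2 a * s - phase s (lam k)) * ip a.2 (e k).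
Proof.
move=> he; rewrite /profile /= -scaleN1r.
have -> : -1 = (-1 : R)%:C :> R[i] by rewrite rmorphN1.
rewrite (op_expi_coord _ _
  (eigenbasis_shift_funcalc (delta * nonlin ip f2 a * s) (-1) (phase s) he)).
by rewrite mulN1r.
Qed.

Hypotheses (hf1 : C2 f1) (hf1_hess : bounded_hessian f1).
Hypotheses (hf2 : C2 f2) (hf2_hess : bounded_hessian f2).

Section Family.
Variables (T : Type) (u0 : T -> H * H) (u : T -> R -> H * H).
Hypothesis hu0 : forall t, hnorm2 ip (u0 t) = 1.
Hypothesis hu : forall t, sol (u0 t) (u t).

Let N1 t s := hnorm ip (u t s).1 ^+ 2.
Let N2 t s := hnorm ip (u t s).2 ^+ 2.

Let N12 t (s : R) : N1 t s + N2 t s = 1.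
Proof. exact: solution_norm (hu0 t) (hu t). Qed.

Let ip_bound (w : T -> R -> H) v : (forall t (s : R), hnorm ip (w t s) ^+ 2 <= 1) ->
  udecay 0 (fun t s => ip (w t s) v).
Proof.
move=> hw; exists (hnorm ip v) => t s s1; rewrite expr0 divr1.
apply: le_trans (Cauchy_Schwarz_hnorm _ _ _) _.
by rewrite ler_piMl ?sqrtr_ge0// -(@expr_le1 _ 2) ?sqrtr_ge0.
Qed.

Let N1_le1 t (s : R) : N1 t s <= 1.
Proof. by rewrite -(N12 t s) lerDl sqr_ge0. Qed.

Let N2_le1 t (s : R) : N2 t s <= 1.
Proof. by rewrite -(N12 t s) lerDr sqr_ge0. Qed.

(** The second norm is written as $1-\|\omega_1\|^2$ because the limit of $u_2$ is constructed
    independently. *)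
Lemma family_asymptotics1 n (e : 'I_n -> H) (lam : 'I_n -> R) : eigenbasis ip GGs e lam ->
  exists om : T -> H,
    udecay 1 (fun t s => (N1 t s)%:C - (hnorm ip (om t) ^+ 2)%:C) /\
    forall k, udecay 1 (fun t s => ip (u t s).1 (e k) -
      expi (delta * f1 (hnorm ip (om t) ^+ 2, 1 - hnorm ip (om t) ^+ 2) * s + phase s (lam k))
        * ip (om t) (e k)).
Proof.
move=> he.
have [e1' [K1 h1]] := quadratic_approx_on_simplex delta hf1 hf1_hess.
have [e2' [K2 h2]] := quadratic_approx_on_simplex delta hf2 hf2_hess.
pose c t k s := ip (u t s).1 (e k).
pose g t k s := ip (G (u t s).2) (e k).
have NE t s : \sum_k normc (c t k s) ^+ 2 = N1 t s by rewrite /N1 (hnorm_parseval he).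
have N21' t s : 1 - N1 t s = N2 t s by rewrite -(N12 t s) addrAC subrr add0r.
have [||||gam [hN hg]] := oscillator_asymptotics (lam := lam) (c := c) (g := g) h1 h2.
- by move=> t s _; rewrite NE.
- move=> k; have := ip_bound (Gs (e k)) (fun t s => N2_le1 t s).
  by apply: udecay_ext => t s _; rewrite /g hadj.
- move=> t k s s1; rewrite NE N21'.
  exact: solution_coord1 (hu t).
- move=> t k s s1; rewrite NE N21'.
  (* Testing $u_2$ against $G^*e_k$ gives $\langle Gu_2,e_k\rangle$, and the coupling term becomes
     $\langle GG^*u_1,e_k\rangle=\lambda_k\langle u_1,e_k\rangle$, which closes the system. *)
  have h : cderiv (fun r => ip (u t r).2 (Gs (e k))) s _ := solution_coord2 s _ (hu t).
  apply: cderiv_eq (cderiv_ext _ h) _ => [r|]; first by rewrite /g hadj.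
  rewrite -!hadj -(eigenbasis_coord he) /GGs !lfunE /= /g; ring.
pose om t := \sum_k gam t k *: e k.
have omE t k : ip (om t) (e k) = gam t k.
  have [ee _ _] := he; rewrite /om ip_suml (bigD1 k)//= big1 => [|j jk].
    by rewrite addr0 ipZl ee eqxx mulr1.
  by rewrite ipZl ee (negbTE jk) mulr0.
have hom t : hnorm ip (om t) ^+ 2 = \sum_k normc (gam t k) ^+ 2.
  by rewrite (hnorm_parseval he); apply: eq_bigr => k _; rewrite omE.
exists om; split.
  by apply: udecay_ext hN => t s _; rewrite NE hom.
by move=> k; apply: udecay_ext (hg k) => t s _; rewrite hom omE.
Qed.

(* Conjugation turns the phase [- s^2 / 2] of the second component into the
   phase of the oscillator system, at the price of changing the sign of [delta]. *)
Lemma family_asymptotics2 n (e : 'I_n -> H) (lam : 'I_n -> R) : eigenbasis ip GsG e lam ->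
  exists om : T -> H,
    udecay 1 (fun t s => (N2 t s)%:C - (hnorm ip (om t) ^+ 2)%:C) /\
    forall k, udecay 1 (fun t s => ip (u t s).2 (e k) -
      expi (delta * f2 (1 - hnorm ip (om t) ^+ 2, hnorm ip (om t) ^+ 2) * s - phase s (lam k))
        * ip (om t) (e k)).
Proof.
move=> he.
have [e1' [K1 /quadratic_approx_reflect h1]] := quadratic_approx_on_simplex (- delta) hf2 hf2_hess.
have [e2' [K2 /quadratic_approx_reflect h2]] := quadratic_approx_on_simplex (- delta) hf1 hf1_hess.
pose c t k s := conjc (ip (u t s).2 (e k)).
(* Conjugation sends $i$ to $-i$; pulling out a factor $i$ again restores $+s$ in front of [c] and
   leaves the coupling with this minus sign. *)
pose g t k s := - conjc (ip (Gs (u t s).1) (e k)).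
have NE t s : \sum_k normc (c t k s) ^+ 2 = N2 t s.
  by rewrite /N2 (hnorm_parseval he); apply: eq_bigr => k _; rewrite normcJ_real.
have hadj' := adjoint_sym hadj.
have N21 t s : 1 - N2 t s = N1 t s by rewrite -(N12 t s) addrK.
have N21' t s : 1 - N1 t s = N2 t s by rewrite -(N12 t s) addrAC subrr add0r.
have [||||gam [hN hg]] := oscillator_asymptotics (lam := lam) (c := c) (g := g) h1 h2.
- by move=> t s _; rewrite NE.
- move=> k; have := udecayN (udecayJ (ip_bound (G (e k)) (fun t s => N1_le1 t s))).
  by apply: udecay_ext => t s _; rewrite /g hadj'.
- move=> t k s s1; rewrite NE N21 N21'.
  apply: cderiv_eq (cderivJ (solution_coord2 s (e k) (hu t))) _.
  rewrite !(conjcM, conjcD, conjcN, conjcB) conjc_i !conjc_real /c /g.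
  by rewrite /nonlin -/(N1 t s) -/(N2 t s); ring.
- move=> t k s s1; rewrite NE N21 N21'.
  have h : cderiv (fun r => ip (u t r).1 (G (e k))) s _ := solution_coord1 s _ (hu t).
  apply: cderiv_eq (cderiv_ext _ (cderivN (cderivJ h))) _ => [r|]; first by rewrite /g hadj'.
  rewrite -!hadj'.
  have -> : ip (Gs (G (u t s).2)) (e k) = (lam k)%:C * ip (u t s).2 (e k).
    by rewrite -(eigenbasis_coord he) /GsG !lfunE.
  rewrite !(conjcM, conjcD, conjcN, conjcB) conjc_i !conjc_real /c /g.
  by rewrite /nonlin -/(N1 t s) -/(N2 t s); ring.
pose om t := \sum_k conjc (gam t k) *: e k.
have omE t k : ip (om t) (e k) = conjc (gam t k).
  have [ee _ _] := he; rewrite /om ip_suml (bigD1 k)//= big1 => [|j jk].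
    by rewrite addr0 ipZl ee eqxx mulr1.
  by rewrite ipZl ee (negbTE jk) mulr0.
have hom t : hnorm ip (om t) ^+ 2 = \sum_k normc (gam t k) ^+ 2.
  by rewrite (hnorm_parseval he); apply: eq_bigr => k _; rewrite omE normcJ_real.
exists om; split.
  by apply: udecay_ext hN => t s _; rewrite NE hom.
move=> k; apply: udecay_ext (udecayJ (hg k)) => t s _.
rewrite hom omE conjcB conjcM -expiN conjcK; congr (_ - expi _ * _).
by rewrite subKr; ring.
Qed.

Lemma hnorm_udecay n (A : 'End(H)) (e : 'I_n -> H) (lam : 'I_n -> R) (w : T -> R -> H) :
  eigenbasis ip A e lam -> (forall k, udecay 1 (fun t s => ip (w t s) (e k))) ->
  exists C, forall t (s : R), 1 <= s -> hnorm ip (w t s) <= C / s.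
Proof.
move=> he hw.
have [|C hC] := @udecay_sum _ T 1 _ (index_enum 'I_n)
  (fun k t s => (normc (ip (w t s) (e k)))%:C).
  move=> k; have [C hC] := hw k; exists C => t s s1.
  by rewrite normc_real ger0_norm ?normc_ge0 ?hC.
exists C => t s s1; apply: le_trans (hnorm_le_sum he _) _.
have := hC t s s1; rewrite expr1; apply: le_trans.
by rewrite -rmorph_sum normc_real ler_norm.
Qed.

Lemma family_forward_state : exists C (om : T -> H * H),
  forall t, expansion_pinfty ip G Gs delta f1 f2 C 1 (u t) (om t).
Proof.
have [n1 [e1 [lam1 he1]]] := self_adjoint_eigenbasis (adjoint_comp hadj).
have [n2 [e2 [lam2 he2]]] := self_adjoint_eigenbasis (adjoint_comp (adjoint_sym hadj)).
have [om1 [hN1 h1]] := family_asymptotics1 he1.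
have [om2 [hN2 h2]] := family_asymptotics2 he2.
pose om t := (om1 t, om2 t).
(* The two limits were found separately; conservation of the norm passes to them and makes both
   frequencies those of the pair [om t]. *)
have om12 t : hnorm ip (om1 t) ^+ 2 + hnorm ip (om2 t) ^+ 2 = 1.
  have : udecay 1 (fun t (_ : R) => (1 - (hnorm ip (om1 t) ^+ 2 + hnorm ip (om2 t) ^+ 2))%:C).
    apply: udecay_ext (udecayD hN1 hN2) => r s _.
    by rewrite -(N12 r s) rmorphB !rmorphD /=; ring.
  by move=> /udecay1_cst/(_ t) [/eqP]; rewrite subr_eq0 => /eqP.
have [C1 hC1] : exists C, forall t (s : R), 1 <= s ->
    hnorm ip ((u t s).1 - (profile ip G Gs delta f1 f2 (om t) s).1) <= C / s.
  apply: (hnorm_udecay he1) => k; apply: udecay_ext (h1 k) => t s _.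
  rewrite ipBl (profile_coord1 _ _ _ he1) /nonlin /=; congr (_ - expi (_ * f1 (_, _) * _ + _) * _).
  by rewrite -(om12 t) addrAC subrr add0r.
have [C2 hC2] : exists C, forall t (s : R), 1 <= s ->
    hnorm ip ((u t s).2 - (profile ip G Gs delta f1 f2 (om t) s).2) <= C / s.
  apply: (hnorm_udecay he2) => k; apply: udecay_ext (h2 k) => t s _.
  rewrite ipBl (profile_coord2 _ _ _ he2) /nonlin /=; congr (_ - expi (_ * f2 (_, _) * _ - _) * _).
  by rewrite -(om12 t) addrK.
exists (Num.max C1 C2), om => t s s1; have s0 : 0 < s by apply: lt_le_trans s1.
rewrite /remainder_le gtr0_norm//; split.
  by apply: le_trans (hC1 t s s1) _; rewrite ler_wpM2r ?invr_ge0 ?(ltW s0)// le_max lexx.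
by apply: le_trans (hC2 t s s1) _; rewrite ler_wpM2r ?invr_ge0 ?(ltW s0)// le_max lexx orbT.
Qed.

End Family.

(** Taking all normalised solutions as the index type turns uniformity over the family into a
    constant chosen before [u0] and [u]. *)
Theorem forward_state : exists C, forall (u0 : H * H) u, hnorm2 ip u0 = 1 -> sol u0 u ->
  exists om, expansion_pinfty ip G Gs delta f1 f2 C 1 u om.
Proof.
pose T := {w : (H * H) * (R -> H * H) | hnorm2 ip w.1 = 1 /\ sol w.1 w.2}.
have [C [om h]] := @family_forward_state T (fun t => (sval t).1) (fun t => (sval t).2)
  (fun t => (svalP t).1) (fun t => (svalP t).2).
exists C => u0 u n0 su; exists (om (exist _ (u0, u) (conj n0 su))).
exact: (h (exist _ (u0, u) (conj n0 su))).
Qed.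

End Evolution.

(** * Uniqueness of the asymptotic state *)

Lemma le0_of_decay (d C S : R) : (forall s, S <= s -> 1 <= s -> d <= C / s) -> d <= 0.
Proof.
move=> h; rewrite leNgt; apply/negP => d0.
(* With $s\ge C/d+1$ one gets $ds\ge C+d>C$, against the hypothesis. *)
pose s := Num.max (Num.max S 1) (C / d + 1).
have s1 : 1 <= s by rewrite /s !le_max lexx !orbT.
have sS : S <= s by rewrite /s !le_max lexx.
have := h s sS s1; rewrite ler_pdivlMr ?(lt_le_trans ltr01)// leNgt => /negP; apply.
have : C / d + 1 <= s by rewrite /s le_max lexx orbT.
move=> /(ler_wpM2l (ltW d0)); rewrite mulrDr mulrCA divff ?gt_eqF// !mulr1.
by apply: lt_le_trans; rewrite ltrDl.
Qed.

(** The phases may differ here, since the frequency depends on the candidate state; only moduli can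
    be compared at this stage. *)
Lemma oscillation_close_normc (th th' : R -> R) (x y : R[i]) (C S : R) :
  (forall s, S <= s -> 1 <= s -> normc (expi (th s) * x - expi (th' s) * y) <= C / s) ->
  normc x = normc y.
Proof.
move=> h; apply/eqP; rewrite eq_le -!(subr_le0 (normc _)).
have tri (z z' : R[i]) : normc z - normc z' <= normc (z - z').
  by rewrite lerBlDr -{1}(subrK z' z) le_normcD.
have modE (r : R) z : normc (expi r * z) = normc z.
  by rewrite ComplexField.Normc.normcM normc_expi mul1r.
apply/andP; split; apply: (le0_of_decay (S := S) (C := C)) => s sS s1;
  apply: le_trans (h s sS s1).
  by have := tri (expi (th s) * x) (expi (th' s) * y); rewrite !modE.
have := tri (expi (th' s) * y) (expi (th s) * x); rewrite !modE.
by rewrite -(normcN (_ - _)) opprB.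
Qed.

Lemma oscillation_close_eq (th : R -> R) (x y : R[i]) (C S : R) :
  (forall s, S <= s -> 1 <= s -> normc (expi (th s) * x - expi (th s) * y) <= C / s) ->
  x = y.
Proof.
move=> h; apply/eqP; rewrite -subr_eq0; apply/eqP/ComplexField.Normc.eq0_normc.
apply/eqP; rewrite eq_le normc_ge0 andbT.
apply: (le0_of_decay (S := S) (C := C)) => s sS s1; apply: le_trans (h s sS s1).
by rewrite -mulrBr ComplexField.Normc.normcM normc_expi mul1r.
Qed.

Lemma forward_state_unique (G Gs : 'End(H)) (delta : R) (f1 f2 : R * R -> R)
    u a a' (C C' S S' : R) : is_adjoint ip G Gs ->
  expansion_pinfty ip G Gs delta f1 f2 C S u a ->
  expansion_pinfty ip G Gs delta f1 f2 C' S' u a' -> a' = a.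
Proof.
move=> hadj ha ha'.
have [n1 [e1 [lam1 he1]]] := self_adjoint_eigenbasis (adjoint_comp hadj).
have [n2 [e2 [lam2 he2]]] := self_adjoint_eigenbasis (adjoint_comp (adjoint_sym hadj)).
have close (x y y' v : H) (s : R) : 1 <= s -> hnorm ip (x - y) <= C / `|s| ->
    hnorm ip (x - y') <= C' / `|s| ->
    normc (ip y' v - ip y v) <= (C + C') * hnorm ip v / s.
  move=> s1; rewrite ger0_norm ?(le_trans ler01)// => h h'.
  have -> : ip y' v - ip y v = ip (x - y) v - ip (x - y') v by rewrite !ipBl; ring.
  apply: le_trans (le_normcD _ _) _; rewrite normcN.
  apply: le_trans (lerD (Cauchy_Schwarz_hnorm _ _ _) (Cauchy_Schwarz_hnorm _ _ _)) _.
  by rewrite -mulrDl mulrAC ler_wpM2r ?sqrtr_ge0// mulrDl lerD.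
have h1 k s : Num.max S S' <= s -> 1 <= s ->
    normc (expi (delta * nonlin ip f1 a' * s + phase s (lam1 k)) * ip a'.1 (e1 k)
      - expi (delta * nonlin ip f1 a * s + phase s (lam1 k)) * ip a.1 (e1 k))
    <= (C + C') * hnorm ip (e1 k) / s.
  rewrite ge_max => /andP[sS sS'] s1.
  rewrite -(profile_coord1 delta f1 f2 a' s k he1) -(profile_coord1 delta f1 f2 a s k he1).
  exact: close (ha s sS).1 (ha' s sS').1.
have h2 k s : Num.max S S' <= s -> 1 <= s ->
    normc (expi (delta * nonlin ip f2 a' * s - phase s (lam2 k)) * ip a'.2 (e2 k)
      - expi (delta * nonlin ip f2 a * s - phase s (lam2 k)) * ip a.2 (e2 k))
    <= (C + C') * hnorm ip (e2 k) / s.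
  rewrite ge_max => /andP[sS sS'] s1.
  rewrite -(profile_coord2 delta f1 f2 a' s k he2) -(profile_coord2 delta f1 f2 a s k he2).
  exact: close (ha s sS).2 (ha' s sS').2.
have N1 : hnorm ip a'.1 ^+ 2 = hnorm ip a.1 ^+ 2.
  rewrite !(hnorm_parseval he1); apply: eq_bigr => k _; congr (_ ^+ 2).
  exact: oscillation_close_normc (h1 k).
have N2 : hnorm ip a'.2 ^+ 2 = hnorm ip a.2 ^+ 2.
  rewrite !(hnorm_parseval he2); apply: eq_bigr => k _; congr (_ ^+ 2).
  exact: oscillation_close_normc (h2 k).
have nl f : nonlin ip f a' = nonlin ip f a by rewrite /nonlin N1 N2.
have E1 : a'.1 = a.1.
  apply: (coord_inj he1) => k; have := h1 k; rewrite nl.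
  exact: oscillation_close_eq.
have E2 : a'.2 = a.2.
  apply: (coord_inj he2) => k; have := h2 k; rewrite nl.
  exact: oscillation_close_eq.
by rewrite (surjective_pairing a') E1 E2 -surjective_pairing.
Qed.

(** * Time reversal *)

Lemma has_hderive_reverse (w : R -> H) (s : R) (d : H) :
  has_hderive ip w (- s) d -> has_hderive ip (fun t => w (- t)) s (- d).
Proof.
move=> h.
have dN : ((-%R : R -> R) @ 0^' --> 0^')%classic.
  move=> A [r /= r0 hA]; exists r => //= x; rewrite /= sub0r normrN => xr x0.
  by apply: hA; rewrite /= ?sub0r ?normrN ?oppr_eq0.
have e : (fun r : R => hnorm ip ((r^-1)%:C *: (w (- (s + r)) - w (- s)) - - d)) =
    (fun r : R => hnorm ip ((r^-1)%:C *: (w (- s + r) - w (- s)) - d)) \o -%R.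
  apply/funext => r /=; rewrite invrN rmorphN scaleNr -opprD /hnorm hnormN.
  by rewrite opprK opprD.
rewrite /has_hderive e; exact: cvg_comp dN h.
Qed.

Lemma solution_reverse (G Gs : 'End(H)) (delta : R) (f1 f2 : R * R -> R) (u0 : H * H) u :
  is_solution ip G Gs delta f1 f2 u0 u ->
  is_solution ip (- G) (- Gs) (- delta) f1 f2 u0 (fun s => u (- s)).
Proof.
move=> [uu0 hu]; split; first by rewrite oppr0.
move=> s; have [du [h1 h2 eq1 eq2]] := hu (- s).
exists (- du); split.
- exact: has_hderive_reverse h1.
- exact: has_hderive_reverse h2.
- by rewrite scalerN eq1 !lfunE /= mulNr !rmorphN !scaleNr !opprD !opprK.
- by rewrite scalerN eq2 !lfunE /= mulNr !rmorphN !scaleNr !opprD !opprK.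
Qed.

(** The products $GG^*$ and $G^*G$ do not see the signs, the phase is even in $s$, and
    $(-\delta)s=\delta(-s)$. *)
Lemma profile_reverse (G Gs : 'End(H)) (delta : R) (f1 f2 : R * R -> R) a s :
  profile ip (- G) (- Gs) (- delta) f1 f2 a s = profile ip G Gs delta f1 f2 a (- s).
Proof.
have compNN (F F' : 'End(H)) : (- F \o - F' = F \o F')%VF.
  by apply/lfunP => x; rewrite !lfunE /= !lfunE /= linearN opprK.
have phN : phase s = phase (- s).
  by apply/funext => l; rewrite /phase sqrrN normrN.
by rewrite /profile !compNN phN !mulNr !mulrN.
Qed.

Lemma expansion_reverse (G Gs : 'End(H)) (delta : R) (f1 f2 : R * R -> R) u a (C S : R) :
  expansion_pinfty ip (- G) (- Gs) (- delta) f1 f2 C S (fun s => u (- s)) a <->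
  expansion_ninfty ip G Gs delta f1 f2 C S u a.
Proof.
split=> h s hs.
  have := h (- s); rewrite lerNr => /(_ hs).
  by rewrite /remainder_le profile_reverse !opprK normrN.
have := h (- s); rewrite lerN2 => /(_ hs).
by rewrite /remainder_le profile_reverse normrN.
Qed.

End Solutions.

(** * Both time directions together *)

Theorem theorem1p3 (R : realType) (H : vectType R[i]) (ip : {dot H for Num.conj})
    (G Gs : 'End(H)) (delta : R) (f1 f2 : R * R -> R) (theta : R -> R)
    (hadj : is_adjoint ip G Gs)
    (hint : intertwining ip G Gs)
    (hf1 : C2 f1) (hf1_hess : bounded_hessian f1)
    (hf2 : C2 f2) (hf2_hess : bounded_hessian f2)
    (htheta : is_cutoff theta) :
  forall r : R, 0 < r ->
  exists C S : R, 0 < S /\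
  forall (u0 : H * H) (u : R -> H * H),
    hnorm2 ip u0 = 1 ->
    u0 = Theta ip G Gs theta r u0 ->
    is_solution ip G Gs delta f1 f2 u0 u ->
  exists alpha omega : H * H,
    [/\ expansion_ninfty ip G Gs delta f1 f2 C S u alpha,
        expansion_pinfty ip G Gs delta f1 f2 C S u omega,
        forall (C' S' : R) (alpha' : H * H),
          expansion_ninfty ip G Gs delta f1 f2 C' S' u alpha' -> alpha' = alpha &
        forall (C' S' : R) (omega' : H * H),
          expansion_pinfty ip G Gs delta f1 f2 C' S' u omega' -> omega' = omega].
Proof.
move=> r r0.
have [C1 hfwd] := forward_state delta hadj hf1 hf1_hess hf2 hf2_hess.
have hadjN : is_adjoint ip (- G)%VF (- Gs)%VF.
  move=> x y; rewrite !opp_lfunE -(scaleN1r (G x)) -(scaleN1r (Gs y)).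
  by rewrite ipZl ipZr hadj conjcN conjc1.
have [C2 hbwd] := forward_state (- delta) hadjN hf1 hf1_hess hf2 hf2_hess.
have le_expansion C C' u a G' Gs' d : C <= C' ->
    expansion_pinfty ip G' Gs' d f1 f2 C 1 u a ->
    expansion_pinfty ip G' Gs' d f1 f2 C' 1 u a.
  move=> CC' h s s1; have [h1 h2] := h s s1.
  have CsC's : C / `|s| <= C' / `|s| by rewrite ler_wpM2r ?invr_ge0.
  by split; [exact: le_trans h1 CsC's | exact: le_trans h2 CsC's].
(* One constant per time direction, both valid from $|s|\ge1$ on and both fixed before the
   solution. *)
exists (Num.max C1 C2), 1; split=> // u0 u n0 _ su.
have [omega homega] := hfwd u0 u n0 su.
have [alpha halpha] := hbwd u0 _ n0 (solution_reverse su).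
exists alpha, omega; split.
- by apply/expansion_reverse; apply: le_expansion halpha; rewrite le_max lexx orbT.
- by apply: le_expansion homega; rewrite le_max lexx.
- move=> C' S' alpha' /expansion_reverse; exact: (forward_state_unique hadjN halpha).
- move=> C' S' omega'; exact: (forward_state_unique hadj homega).
Qed.
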